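(* In the $\rho$-Bockstein spectral sequence $E^-$ converging to $\mathrm{Ext}_{NC}(1)$, for all $k\ge0$: (1) $d_1\left(\frac{\gamma}{\rho\,\tau^{2k+1}}\right)=\frac{\gamma}{\tau^{2k+2}}h_0$. (2) $d_1\left(\frac{Q}{\rho}h_1^3\right)=\frac{\gamma}{\tau^2}a$. These differentials are infinitely divisible by $\rho$.
   Context: Let $\mathbb{M}_2^{\mathbb{R}}=\mathbb{F}_2[\tau,\rho]$, and let $NC$ be the $\mathbb{F}_2$-vector space with basis the symbols $\frac{\gamma}{\rho^j\tau^k}$ ($j\ge0$, $k\ge1$), with $\tau\cdot\frac{\gamma}{\rho^j\tau^k}=\frac{\gamma}{\rho^j\tau^{k-1}}$ (zero if $k=1$) and $\rho\cdot\frac{\gamma}{\rho^j\tau^k}=\frac{\gamma}{\rho^{j-1}\tau^k}$ (zero if $j=0$). The Hopf algebroid $\mathcal{A}^{\mathbb{R}}_*(1)$ over $\mathbb{M}_2^{\mathbb{R}}$ is $\mathbb{M}_2^{\mathbb{R}}[\tau_0,\tau_1,\xi_1]/(\xi_1^2,\ \tau_0^2=\rho\tau_1+\tau\xi_1+\rho\tau_0\xi_1,\ \tau_1^2)$ with $\eta_R(\rho)=\rho$, $\eta_R(\tau)=\tau+\rho\tau_0$, $\tau_0,\xi_1$ primitive, $\Delta(\tau_1)=\tau_1\otimes1+\xi_1\otimes\tau_0+1\otimes\tau_1$. $NC$ is an $\mathcal{A}^{\mathbb{R}}_*(1)$-comodule via $\eta_R\left(\frac{\gamma}{\rho^j\tau^k}\right)=\frac{\gamma}{\rho^j\tau^k}\left[\sum_{i\ge0}\left(\frac{\rho}{\tau}\tau_0\right)^i\right]^k$.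 $\mathrm{Ext}_{NC}(1)$ is the cohomology of $\mathcal{A}^{\mathbb{R}}_*(1)$ with coefficients in $NC$ (cohomology of the cobar complex). The spectral sequence $E^-$ arises from filtering the cobar complex by powers of $\rho$ ($\frac{\gamma}{\rho^j\tau^k}$ has filtration $-j$; $d_r$ raises filtration by $r$). Let $\mathrm{Ext}_{\mathbb{C}}(1)=\mathbb{F}_2[\tau][h_0,h_1,a,b]/(h_0h_1,\tau h_1^3,h_1a,a^2+h_0^2b)$ be the cohomology of $\mathcal{A}^{\mathbb{R}}_*(1)/\rho$, with $h_0,h_1,a,b$ in degrees (stem, filtration, weight) $(0,1,0),(1,1,1),(4,3,2),(8,4,4)$. Then $E_1^-$ is a module over $\mathrm{Ext}_{\mathbb{C}}(1)[\rho]$ and sits in a split short exact sequence $$\bigoplus_{s\ge0}\tfrac{\mathbb{F}_2[\tau]}{\tau^\infty}\{\tfrac{\gamma}{\rho^s}\}\otimes_{\mathbb{F}_2[\tau]}\mathrm{Ext}_{\mathbb{C}}(1)\to E_1^-\to\bigoplus_{s\ge0}\mathrm{Tor}_1^{\mathbb{F}_2[\tau]}\left(\tfrac{\mathbb{F}_2[\tau]}{\tau^\infty}\{\tfrac{\gamma}{\rho^s}\},\mathrm{Ext}_{\mathbb{C}}(1)\right),$$ where $\frac{\mathbb{F}_2[\tau]}{\tau^\infty}\{x\}$ has basis $\frac{x}{\tau^k}$, $k\ge1$. For $y\in\mathrm{Ext}_{\mathbb{C}}(1)$, $\frac{\gamma}{\rho^j\tau^k}y$ is the image of $\frac{\gamma}{\rho^j\tau^k}\otimes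 y$. For each $s\ge0$, the submodule $\mathbb{F}_2[\tau]/\tau$ of $\mathrm{Ext}_{\mathbb{C}}(1)$ generated by $h_1^3$ contributes a nonzero element of the $s$-th $\mathrm{Tor}_1$ summand, and $\frac{Q}{\rho^s}h_1^3\in E_1^-$ denotes a lift of it (in degree $(4+s,2,4+s)$). ''A differential $d_r(x)=y$ is infinitely divisible by $\rho$'' means that also $d_r\left(\frac{x}{\rho^j}\right)=\frac{y}{\rho^j}$ for all $j\ge0$, where dividing by $\rho^j$ means increasing the exponent of $\rho$ in the denominator of the symbol by $j$; e.g. (1) also asserts $d_1\left(\frac{\gamma}{\rho^{j+1}\tau^{2k+1}}\right)=\frac{\gamma}{\rho^j\tau^{2k+2}}h_0$. *)

(* Defs.v *)
From HB Require Import structures.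
From mathcomp Require Import all_boot all_order all_algebra finmap.
From mathcomp Require Import boolp generic_quotient.
From mathcomp Require Import monalg.
From mathcomp Require Import mpoly.

Set Implicit Arguments.
Unset Strict Implicit.
Unset Printing Implicit Defensive.

Import GRing.Theory.
Local Open Scope ring_scope.

(* All cochain groups are F_2-vector spaces, so the signs of the cobar
   differential are omitted throughout. *)

(** * Modules over F_2[tau, rho] and the functor N |-> N (x) A *)

(* A module over F_2[tau, rho]: an F_2-vector space with two commuting
   endomorphisms. *)
Record rtmod := RTMod {
  rt_car :> lmodType 'F_2;
  rt_rho : {linear rt_car -> rt_car};
  rt_tau : {linear rt_car -> rt_car};
  rt_comm : forall x, rt_rho (rt_tau x) = rt_tau (rt_rho x) }.

(* The Hopf algebroid A = A^R_*(1) is free as a left F_2[tau, rho]-module on the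
   monomials tau_0^e0 tau_1^e1 xi_1^ex with e0, e1, ex in {0, 1}; such a monomial
   is encoded by (e0, e1, ex). *)
Definition mon : finType := (bool * bool * bool)%type.

(* Internal degree (before the shift by the cobar degree) and weight, from
   |tau_0| = (1, 0), |tau_1| = (3, 1), |xi_1| = (2, 1). *)
Definition mon_deg (m : mon) : nat := (m.1.1 + 3 * m.1.2 + 2 * m.2)%N.
Definition mon_wt (m : mon) : nat := (m.1.2 + m.2)%N.

Lemma linear_add (U V : lmodType 'F_2) (f g : U -> V) :
  linear f -> linear g -> linear (fun x => f x + g x).
Proof. by move=> hf hg c x y; rewrite hf hg scalerDr addrACA. Qed.

Section Tensor.
Variable N : rtmod.

(* N (x) A (tensor over F_2[tau, rho], using the left unit of A) is the
   F_2-vector space of families x = (x_m), which stand for \sum_m x_m (x) m. *)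
Local Notation NA := {ffun mon -> N}.

Definition cwise (M P : Type) (f : M -> P) (x : {ffun mon -> M}) :
  {ffun mon -> P} := [ffun m => f (x m)].

Definition mul_xi1 (x : NA) : NA :=
  [ffun m : mon => if m.2 then x (m.1, false) else 0].
Definition mul_tau1 (x : NA) : NA :=
  [ffun m : mon => if m.1.2 then x (m.1.1, false, m.2) else 0].

(* If x = y + tau_0 z with no tau_0 in y or z, then [free_tau0 x] is tau_0 y
   and [coef_tau0 x] is z. *)
Definition free_tau0 (x : NA) : NA :=
  [ffun m : mon => if m.1.1 then x (false, m.1.2, m.2) else 0].
Definition coef_tau0 (x : NA) : NA :=
  [ffun m : mon => if m.1.1 then 0 else x (true, m.1.2, m.2)].

(* tau_0 (y + tau_0 z) = tau_0 y + (rho tau_1 + tau xi_1 + rho tau_0 xi_1) z,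
   where rho and tau act through the left unit, that is, on coefficients. *)
Definition mul_tau0 (x : NA) : NA :=
  let z := coef_tau0 x in
  free_tau0 x + (cwise (rt_rho N) (mul_tau1 z)
                 + cwise (rt_tau N) (mul_xi1 z)
                 + cwise (rt_rho N) (free_tau0 (mul_xi1 z))).

(* The F_2[tau, rho]-module structure of N (x) A coming from the right unit
   eta_R(rho) = rho, eta_R(tau) = tau + rho tau_0. *)
Definition rho_r (x : NA) : NA := cwise (rt_rho N) x.
Definition tau_r (x : NA) : NA :=
  cwise (rt_tau N) x + cwise (rt_rho N) (mul_tau0 x).

Definition unit_r (x : N) : NA :=
  [ffun m : mon => if m == (false, false, false) then x else 0].

Lemma cwise_linear (M P : lmodType 'F_2) (f : {linear M -> P}) :
  linear (cwise f).
Proof. by move=> c x y; apply/ffunP=> m; rewrite !ffunE linearP. Qed.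
HB.instance Definition _ (M P : lmodType 'F_2) (f : {linear M -> P}) :=
  GRing.isLinear.Build 'F_2 {ffun mon -> M} {ffun mon -> P} _ (cwise f)
    (cwise_linear f).

Lemma mul_xi1_linear : linear mul_xi1.
Proof.
by move=> c x y; apply/ffunP=> m; rewrite !ffunE; case: ifP; rewrite ?scaler0 ?addr0.
Qed.
HB.instance Definition _ :=
  GRing.isLinear.Build 'F_2 NA NA _ mul_xi1 mul_xi1_linear.

Lemma mul_tau1_linear : linear mul_tau1.
Proof.
by move=> c x y; apply/ffunP=> m; rewrite !ffunE; case: ifP; rewrite ?scaler0 ?addr0.
Qed.
HB.instance Definition _ :=
  GRing.isLinear.Build 'F_2 NA NA _ mul_tau1 mul_tau1_linear.

Lemma free_tau0_linear : linear free_tau0.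
Proof.
by move=> c x y; apply/ffunP=> m; rewrite !ffunE; case: ifP; rewrite ?scaler0 ?addr0.
Qed.
HB.instance Definition _ :=
  GRing.isLinear.Build 'F_2 NA NA _ free_tau0 free_tau0_linear.

Lemma coef_tau0_linear : linear coef_tau0.
Proof.
by move=> c x y; apply/ffunP=> m; rewrite !ffunE; case: ifP; rewrite ?scaler0 ?addr0.
Qed.
HB.instance Definition _ :=
  GRing.isLinear.Build 'F_2 NA NA _ coef_tau0 coef_tau0_linear.

Lemma mul_tau0_linear : linear mul_tau0.
Proof.
move=> c x y; rewrite /mul_tau0 !linearP /= !scalerDr.
set p := cwise _ (mul_tau1 _); set q := cwise _ (mul_xi1 _).
by rewrite (addrACA (c *: p)) (addrACA (c *: p + c *: q)) (addrACA (c *: free_tau0 x)).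
Qed.
HB.instance Definition _ :=
  GRing.isLinear.Build 'F_2 NA NA _ mul_tau0 mul_tau0_linear.

Lemma rho_r_linear : linear rho_r. Proof. exact: linearP. Qed.
HB.instance Definition _ :=
  GRing.isLinear.Build 'F_2 NA NA _ rho_r rho_r_linear.

Lemma tau_r_linear : linear tau_r.
Proof. by move=> c x y; rewrite /tau_r !linearP /= scalerDr addrACA. Qed.
HB.instance Definition _ :=
  GRing.isLinear.Build 'F_2 NA NA _ tau_r tau_r_linear.

Lemma unit_r_linear : linear unit_r.
Proof.
by move=> c x y; apply/ffunP=> m; rewrite !ffunE; case: ifP; rewrite ?scaler0 ?addr0.
Qed.
HB.instance Definition _ :=
  GRing.isLinear.Build 'F_2 N NA _ unit_r unit_r_linear.

(* The defining relations of A: xi_1^2 = tau_1^2 = 0 and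
   tau_0^2 = rho tau_1 + tau xi_1 + rho tau_0 xi_1. *)
Lemma mul_xi1_sqr x : mul_xi1 (mul_xi1 x) = 0.
Proof. by apply/ffunP=> -[[e0 e1] ex]; rewrite !ffunE /=; case: ifP. Qed.

Lemma mul_tau1_sqr x : mul_tau1 (mul_tau1 x) = 0.
Proof. by apply/ffunP=> -[[e0 e1] ex]; rewrite !ffunE /=; case: ifP. Qed.

Lemma mul_tau0_sqr x :
  mul_tau0 (mul_tau0 x) = cwise (rt_rho N) (mul_tau1 x)
    + cwise (rt_tau N) (mul_xi1 x) + cwise (rt_rho N) (mul_tau0 (mul_xi1 x)).
Proof.
apply/ffunP=> -[[e0 e1] ex].
rewrite !ffunE /=.
case: e0; case: e1; case: ex; rewrite ?(raddf0, raddfD, addr0, add0r, rt_comm) //=.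
by rewrite addrAC.
Qed.

Lemma rho_tau_r x : rho_r (tau_r x) = tau_r (rho_r x).
Proof.
apply/ffunP=> -[[e0 e1] ex].
rewrite !ffunE /=.
by case: e0; case: e1; case: ex;
  rewrite ?(raddf0, raddfD, addr0, add0r) //= ?rt_comm.
Qed.

End Tensor.

(* N (x) A, as a module through the right unit, so that the construction can be
   iterated. *)
Definition tensA (N : rtmod) : rtmod :=
  @RTMod {ffun mon -> N} (@rho_r N) (@tau_r N) (@rho_tau_r N).

(** * The cobar complex *)

(* [cob N n] is N (x) A (x) ... (x) A with n factors A, the last factor being
   the outermost [tensA]. *)
Definition cob (N : rtmod) (n : nat) : rtmod := iter n tensA N.

Section Coproduct.
Variable N : rtmod.
Local Notation NA := (tensA N).
Local Notation NAA := (tensA (tensA N)).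

(* Multiplication by Delta(xi_1), Delta(tau_1) and Delta(tau_0) on
   N (x) A (x) A; [cwise] makes an element of A act on the inner, that is, the
   first, factor A. *)
Definition mulD_xi1 (x : NAA) : NAA :=
  (cwise (@mul_xi1 N) x : {ffun mon -> NA}) + mul_xi1 x.
Definition mulD_tau1 (x : NAA) : NAA :=
  (cwise (@mul_tau1 N) x : {ffun mon -> NA})
  + (cwise (@mul_xi1 N) (mul_tau0 x) : {ffun mon -> NA}) + mul_tau1 x.
Definition mulD_tau0 (x : NAA) : NAA :=
  (cwise (@mul_tau0 N) x : {ffun mon -> NA}) + mul_tau0 x.

(* x (x) a |-> x (x) Delta(a), where Delta is multiplicative. *)
Definition coprod (x : NA) : NAA :=
  \sum_(m : mon)
     iter m.1.1 mulD_tau0 (iter m.1.2 mulD_tau1 (iter m.2 mulD_xi1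
       (unit_r (unit_r ((x : {ffun mon -> N}) m) : NA)))).

Lemma mulD_xi1_linear : linear mulD_xi1.
Proof. by apply: linear_add; exact: linearP. Qed.
HB.instance Definition _ :=
  GRing.isLinear.Build 'F_2 NAA NAA _ mulD_xi1 mulD_xi1_linear.

Lemma mulD_tau1_linear : linear mulD_tau1.
Proof.
apply: linear_add; last exact: linearP.
by apply: linear_add => c x y; rewrite !linearP.
Qed.
HB.instance Definition _ :=
  GRing.isLinear.Build 'F_2 NAA NAA _ mulD_tau1 mulD_tau1_linear.

Lemma mulD_tau0_linear : linear mulD_tau0.
Proof. by apply: linear_add; exact: linearP. Qed.
HB.instance Definition _ :=
  GRing.isLinear.Build 'F_2 NAA NAA _ mulD_tau0 mulD_tau0_linear.

Lemma iter_linear (V : lmodType 'F_2) (f : {linear V -> V}) k :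
  linear (iter k f).
Proof. by move=> c x y; elim: k => //= k ->; rewrite linearP. Qed.
HB.instance Definition _ (V : lmodType 'F_2) (f : {linear V -> V}) k :=
  GRing.isLinear.Build 'F_2 V V _ (iter k f) (iter_linear f k).

Lemma coprod_linear : linear coprod.
Proof.
move=> c x y; rewrite /coprod scaler_sumr -big_split /=.
by apply: eq_bigr => m _; rewrite !ffunE !linearP.
Qed.
HB.instance Definition _ :=
  GRing.isLinear.Build 'F_2 NA NAA _ coprod coprod_linear.

End Coproduct.

Section Cobar.
Variables (N : rtmod) (psi : {linear N -> tensA N}).

(* The sum of all cofaces of degree n but the last one, x |-> x (x) 1. *)
Fixpoint cob_inner (n : nat) : cob N n -> cob N n.+1 :=
  match n return cob N n -> cob N n.+1 with
  | 0 => psi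
  | n'.+1 => fun x : {ffun mon -> cob N n'} =>
      (coprod x : {ffun mon -> cob N n'.+1}) + cwise (@cob_inner n') x
  end.

(* d(x[a_1|...|a_n]) = psi(x)[a_1|...|a_n] + \sum_i x[a_1|...|Delta(a_i)|...|a_n]
   + x[a_1|...|a_n|1], where psi is the coaction. *)
Definition cob_d (n : nat) (x : cob N n) : cob N n.+1 :=
  (cob_inner x : {ffun mon -> cob N n}) + unit_r x.

Lemma cob_inner_linear n : linear (@cob_inner n).
Proof.
elim: n => [|n IHn]; first exact: linearP.
pose f : {linear cob N n -> cob N n.+1} :=
  HB.pack (@cob_inner n) (GRing.isLinear.Build _ _ _ _ _ IHn).
by apply: linear_add; [exact: linearP | exact: (linearP (cwise f))].
Qed.
HB.instance Definition _ n :=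
  GRing.isLinear.Build 'F_2 (cob N n) (cob N n.+1) _ (@cob_inner n)
    (@cob_inner_linear n).

Lemma cob_d_linear n : linear (@cob_d n).
Proof. by apply: linear_add; exact: linearP. Qed.
HB.instance Definition _ n :=
  GRing.isLinear.Build 'F_2 (cob N n) (cob N n.+1) _ (@cob_d n)
    (@cob_d_linear n).

End Cobar.

(** * Subquotients, cohomology and spectral sequences *)

Record subgroup (V : zmodType) := Subgroup {
  sg_mem :> V -> Prop;
  sg_mem0 : sg_mem 0;
  sg_memB : forall x y, sg_mem x -> sg_mem y -> sg_mem (x - y) }.

Section Subquotient.
Variables (V : zmodType) (Z B : subgroup V).

Definition cycle_pred : {pred V} := fun x => `[< Z x >].
Lemma cycle_closed : zmod_closed cycle_pred.
Proof.
split; first exact/asboolP/sg_mem0.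
by move=> x y /asboolP Zx /asboolP Zy; apply/asboolP/sg_memB.
Qed.
HB.instance Definition _ := GRing.isZmodClosed.Build V cycle_pred cycle_closed.

Record zcycle := ZCycle { cycle_val :> V; _ : cycle_val \in cycle_pred }.
HB.instance Definition _ := [isSub for cycle_val].
HB.instance Definition _ := [Choice of zcycle by <:].
HB.instance Definition _ := [SubChoice_isSubZmodule of zcycle by <:].

Definition bound_pred : {pred zcycle} := fun x => `[< B (val x) >].
Lemma bound_closed : zmod_closed bound_pred.
Proof.
split; first by apply/asboolP; rewrite raddf0; exact: sg_mem0.
move=> x y /asboolP Bx /asboolP By; apply/asboolP.
by rewrite raddfB; exact: sg_memB.
Qed.
HB.instance Definition _ := GRing.isZmodClosed.Build zcycle bound_pred bound_closed.

(* Z / (Z /\ B) *)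
Definition subquot := Quotient.quot (bound_pred : zmodClosed zcycle).

(* The class of x (only meaningful for x in Z), and a representative of a
   class. *)
Definition cls (x : V) : subquot := (\pi_subquot (insubd (0 : zcycle) x))%qT.
Definition rep (u : subquot) : V := val (repr u).

End Subquotient.

Section Complex.
Variables (C : nat -> zmodType) (d : forall n, {additive C n -> C n.+1}).

(* The image under d of a family of subgroups of C 0, C 1, ... *)
Definition im_mem (P : forall n, C n -> Prop) n : C n -> Prop :=
  match n return C n -> Prop with
  | 0 => fun x => x = 0
  | n'.+1 => fun x => exists2 y, P n' y & x = d n' y
  end.

Lemma im_mem0 (P : forall n, subgroup (C n)) n : im_mem P (0 : C n).
Proof. by case: n => //= n; exists 0; [exact: sg_mem0 | rewrite raddf0]. Qed.

Lemma im_memB (P : forall n, subgroup (C n)) n (x y : C n) :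
  im_mem P x -> im_mem P y -> im_mem P (x - y).
Proof.
case: n x y => [|n] x y /=; first by move=> -> ->; rewrite subr0.
move=> [u Pu ->] [v Pv ->]; exists (u - v); first exact: sg_memB.
by rewrite raddfB.
Qed.

Lemma cocycle0 n : d n 0 = 0. Proof. exact: raddf0. Qed.
Lemma cocycleB n x y : d n x = 0 -> d n y = 0 -> d n (x - y) = 0.
Proof. by move=> dx dy; rewrite raddfB dx dy subr0. Qed.
Definition cocycle n : subgroup (C n) := Subgroup (@cocycle0 n) (@cocycleB n).

Definition all_sub n : subgroup (C n) :=
  @Subgroup (C n) (fun=> True) I (fun _ _ _ _ => I).
Definition coboundary n : subgroup (C n) :=
  Subgroup (im_mem0 all_sub n) (@im_memB all_sub n).

Definition cohomology n := subquot (cocycle n) (coboundary n).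

(* The spectral sequence of a decreasing filtration F p (p : int) of (C, d) *)
Variable F : int -> forall n, subgroup (C n).

(* Z_r^p = F^p /\ d^-1 (F^(p+r)) *)
Definition Zr_mem (r : nat) (p : int) n (x : C n) : Prop :=
  F p n x /\ F (p + r%:Z) n.+1 (d n x).
Lemma Zr_mem0 r p n : @Zr_mem r p n 0.
Proof. by split; rewrite ?raddf0; exact: sg_mem0. Qed.
Lemma Zr_memB r p n x y :
  @Zr_mem r p n x -> @Zr_mem r p n y -> @Zr_mem r p n (x - y).
Proof. by move=> [Fx Fdx] [Fy Fdy]; split; rewrite ?raddfB; exact: sg_memB. Qed.
Definition Zr r p n : subgroup (C n) := Subgroup (@Zr_mem0 r p n) (@Zr_memB r p n).

(* Z_(r-1)^(p+1) + d (Z_(r-1)^(p-r+1)), for r >= 1 *)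
Definition Br_mem (r : nat) (p : int) n (x : C n) : Prop :=
  exists u v, [/\ Zr r.-1 (p + 1) n u,
    im_mem (fun m => Zr r.-1 (p - r.-1%:Z) m) v & x = u + v].
Lemma Br_mem0 r p n : @Br_mem r p n 0.
Proof.
exists 0, 0; split; first exact: sg_mem0; last by rewrite addr0.
exact: (im_mem0 (fun m => Zr r.-1 (p - r.-1%:Z) m)).
Qed.
Lemma Br_memB r p n x y :
  @Br_mem r p n x -> @Br_mem r p n y -> @Br_mem r p n (x - y).
Proof.
move=> [u [v [Zu Zv ->]]] [u' [v' [Zu' Zv' ->]]].
exists (u - u'), (v - v'); split; first exact: sg_memB.
  exact: (im_memB (P := fun m => Zr r.-1 (p - r.-1%:Z) m)).
by rewrite opprD addrACA.
Qed.
Definition Br r p n : subgroup (C n) := Subgroup (@Br_mem0 r p n) (@Br_memB r p n).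

(* The part of E_r (r >= 1) of filtration -s and cohomological degree n.  Only
   filtrations <= 0 occur for NC, so they are indexed by s : nat. *)
Definition Er (r s n : nat) := subquot (Zr r (- s%:Z) n) (Br r (- s%:Z) n).

(* d_r [x] = [d x], which does not depend on the representative x because
   d o d = 0; it raises the filtration by r, from -(r + s) to -s. *)
Definition dr r s n (x : Er r (r + s) n) : Er r s n.+1 := cls _ _ (d n (rep x)).

End Complex.


(** * The coefficient modules F_2[tau] and NC *)

(* F_2[tau] = F_2[tau, rho] / rho, on which rho acts by zero; thus [cob Ftau n]
   is the n-fold tensor power of A / rho over F_2[tau]. *)
Definition tau_poly (p : {poly 'F_2}) : {poly 'F_2} := 'X * p.
Lemma tau_poly_linear : linear tau_poly.
Proof. by move=> c p q; rewrite /tau_poly mulrDr scalerAr. Qed.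
HB.instance Definition _ :=
  GRing.isLinear.Build 'F_2 {poly 'F_2} {poly 'F_2} _ tau_poly tau_poly_linear.

Definition rho_poly (p : {poly 'F_2}) : {poly 'F_2} := 0.
Lemma rho_poly_linear : linear rho_poly.
Proof. by move=> c p q; rewrite /rho_poly scaler0 addr0. Qed.
HB.instance Definition _ :=
  GRing.isLinear.Build 'F_2 {poly 'F_2} {poly 'F_2} _ rho_poly rho_poly_linear.

Lemma rho_tau_poly p : rho_poly (tau_poly p) = tau_poly (rho_poly p).
Proof. by rewrite /tau_poly /rho_poly mulr0. Qed.

Definition Ftau : rtmod := @RTMod {poly 'F_2} rho_poly tau_poly rho_tau_poly.

(* NC has basis the symbols gamma / (rho^j tau^k), j >= 0, k >= 1; the pair
   (j, i) stands for the symbol with k = i + 1. *)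
Definition NCspace : lmodType 'F_2 := {malg 'F_2[(nat * nat)%type]}.

(* gamma / (rho^j tau^k), which is 0 for k = 0 *)
Definition gam (j k : nat) : NCspace :=
  if k is i.+1 then mkmalgU (j, i) 1 else 0.

Section LinearExtension.
Variables (V : lmodType 'F_2) (f : nat * nat -> V).
Definition linext (x : NCspace) : V :=
  \sum_(s <- monalg.msupp x) monalg.mcoeff s x *: f s.

Lemma linextw (D : {fset (nat * nat)%type}) x : (monalg.msupp x `<=` D)%fset ->
  linext x = \sum_(s <- D) monalg.mcoeff s x *: f s.
Proof.
move=> sub; rewrite /linext; apply: big_fset_incl => //.
by move=> s _ /monalg.mcoeff_outdom ->; rewrite scale0r.
Qed.

Lemma linext_linear : linear linext.
Proof.
move=> c x y; pose D := (monalg.msupp x `|` monalg.msupp y)%fset.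
rewrite (@linextw D (c *: x + y)) ?(@linextw D x) ?(@linextw D y).
- rewrite scaler_sumr -big_split /=; apply: eq_bigr => s _.
  by rewrite monalg.mcoeffD monalg.mcoeffZ scalerDl scalerA.
- exact: fsubsetUr.
- exact: fsubsetUl.
apply: fsubset_trans (monalg.msuppD_le _ _) _; apply: fsetSU; exact: monalg.msuppZ_le.
Qed.
HB.instance Definition _ :=
  GRing.isLinear.Build 'F_2 NCspace V _ linext linext_linear.

Lemma linextU s : linext (mkmalgU s 1) = f s.
Proof.
rewrite (@linextw [fset s]%fset) ?monalg.msuppU_le // big_seq_fset1.
by rewrite monalg.mcoeffUU scale1r.
Qed.
End LinearExtension.

Definition rho_NC : NCspace -> NCspace :=
  linext (fun s => if s.1 is j.+1 then gam j s.2.+1 else 0).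
HB.instance Definition _ := GRing.Linear.on rho_NC.
Definition tau_NC : NCspace -> NCspace := linext (fun s => gam s.1 s.2).
HB.instance Definition _ := GRing.Linear.on tau_NC.

Lemma eq_linear_gam (V : lmodType 'F_2) (f g : {linear NCspace -> V}) :
  (forall j i, f (gam j i.+1) = g (gam j i.+1)) -> f =1 g.
Proof.
move=> fg x; rewrite (monalgE x) !linear_sum; apply: eq_bigr => -[j i] _.
have -> : mkmalgU (j, i) (monalg.mcoeff (j, i) x) = monalg.mcoeff (j, i) x *: gam j i.+1.
  apply/malgP => s; rewrite monalg.mcoeffZ /= !monalg.mcoeffU.
  by case: eqP; rewrite ?mulr1 ?mulr0.
by rewrite !linearZ /= fg.
Qed.

Lemma rho_gam j k : rho_NC (gam j k) = if j is j'.+1 then gam j' k else 0.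
Proof. by case: k => [|i]; [rewrite linear0; case: j | rewrite /rho_NC linextU]. Qed.

Lemma tau_gam j k : tau_NC (gam j k) = gam j k.-1.
Proof. by case: k => [|i]; [rewrite linear0 | rewrite /tau_NC linextU]. Qed.

Lemma rho_tau_NC x : rho_NC (tau_NC x) = tau_NC (rho_NC x).
Proof.
apply: (@eq_linear_gam _ (rho_NC \o tau_NC) (tau_NC \o rho_NC)) x => j i.
rewrite -[LHS]/(rho_NC (tau_NC _)) -[RHS]/(tau_NC (rho_NC _)).
rewrite tau_gam !rho_gam; case: j => [|j]; first by rewrite linear0.
by rewrite tau_gam.
Qed.

Definition NC : rtmod := @RTMod NCspace rho_NC tau_NC rho_tau_NC.

(* The coaction of F_2[tau]: eta_R(tau) = tau modulo rho. *)
Definition psi_tau : {linear Ftau -> tensA Ftau} := @unit_r Ftau.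

(* The coaction of NC: gamma / (rho^j tau^k) is sent to
     gamma / (rho^j tau^k) [\sum_(i >= 0) ((rho / tau) tau_0)^i]^k
       = \sum_(i >= 0) c_i gamma / (rho^(j-i) tau^(k+i)) tau_0^i,
   where c_i is the coefficient of X^i in (1 + X + X^2 + ...)^k.  The terms with
   i > j vanish, so the geometric series may be truncated after X^j. *)
Definition psi_gam (j k : nat) : tensA NC :=
  \sum_(i < j.+1) ((\sum_(l < j.+1) 'X^l) ^+ k : {poly 'F_2})`_i
     *: iter i (@mul_tau0 NC) (@unit_r NC (gam (j - i) (k + i))).
Definition psi_NC : {linear NC -> tensA NC} :=
  linext (fun s => psi_gam s.1 s.2.+1) : {linear NCspace -> tensA NC}.

(** * Ext_C(1) *)

Definition dC n : {linear cob Ftau n -> cob Ftau n.+1} := @cob_d _ psi_tau n.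

Definition ExtC (n : nat) : zmodType := cohomology dC n.
Definition clsC n (z : cob Ftau n) : ExtC n :=
  cls (cocycle dC n) (coboundary dC n) z.

(* p(tau) x, for x in a module *)
Definition tau_eval (N : rtmod) (p : {poly 'F_2}) (x : N) : N :=
  \sum_(i < size p) p`_i *: iter i (rt_tau N) x.

(* The juxtaposition product
   (p[a_1|...|a_m]) (q[b_1|...|b_n]) = p q [a_1|...|a_m|b_1|...|b_n]. *)
Fixpoint juxt m (x : cob Ftau m) n : cob Ftau n -> cob Ftau (n + m) :=
  match n return cob Ftau n -> cob Ftau (n + m) with
  | 0 => fun q : {poly 'F_2} => tau_eval q x
  | n'.+1 => fun y : {ffun mon -> cob Ftau n'} =>
      [ffun c => @juxt m x n' (y c)] : {ffun mon -> cob Ftau (n' + m)}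
  end.

(* The product induced on cohomology, computed on representatives: juxtaposition
   satisfies the Leibniz rule. *)
Definition ext_mul m n (u : ExtC m) (v : ExtC n) : ExtC (n + m) :=
  clsC (juxt (rep u) (rep v)).

Definition oneC : ExtC 0 := @clsC 0 (1 : {poly 'F_2}).
Definition tauC : ExtC 0 := @clsC 0 ('X : {poly 'F_2}).

(* Homogeneous cochains of given stem and weight in N (x) A^n, from a notion of
   homogeneous element of N: a factor a of degree t contributes t - 1 to the
   stem. *)
Fixpoint cob_deg (N : rtmod) (degN : int -> int -> N -> Prop) n (s w : int) :
    cob N n -> Prop :=
  match n return cob N n -> Prop with
  | 0 => degN s w
  | n'.+1 => fun x : {ffun mon -> cob N n'} =>
      forall m, cob_deg degN (s - ((mon_deg m)%:Z - 1)) (w - (mon_wt m)%:Z) (x m)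
  end.

(* tau has stem 0 and weight -1. *)
Definition deg_Ftau (s w : int) (p : Ftau) : Prop :=
  forall i, (p : {poly 'F_2})`_i != 0 -> s = 0 /\ w = - i%:Z.

(* u has degree (s, n, w), where n is the cohomological degree of u. *)
Definition degC n (s w : int) (u : ExtC n) : Prop :=
  exists z : cob Ftau n, [/\ dC n z = 0, cob_deg deg_Ftau s w z & u = clsC z].

(* The bigraded ring Ext_C(1), with elements tagged by their degree n *)
Definition gradedC := {n : nat & ExtC n}.
Definition inC n (u : ExtC n) : gradedC := Tagged ExtC u.
Definition gext_mul (u v : gradedC) : gradedC := inC (ext_mul (tagged u) (tagged v)).
Definition gext_one : gradedC := inC oneC.
Definition gext_exp (u : gradedC) (k : nat) : gradedC := iter k (gext_mul u) gext_one.

(* The degree n component of the value at g of a polynomial over F_2 in five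
   variables. *)
Definition evalC (g : 5.-tuple gradedC) (f : mpoly 5 'F_2) n : ExtC n :=
  \sum_(m <- mpoly.msupp f)
     untag (0 : ExtC n) (fun u : ExtC n => u) (\big[gext_mul/gext_one]_(i < 5) gext_exp (tnth g i) (m i)).

Definition var (i : nat) : mpoly 5 'F_2 := mpolyX _ (mnm1 (inord i)).

(* h0, h1, a, b are generators of the indicated degrees for which
   Ext_C(1) = F_2[tau][h0, h1, a, b] / (h0 h1, tau h1^3, h1 a, a^2 + h0^2 b):
   Ext_C(1) is commutative, and evaluation at (tau, h0, h1, a, b) is onto with
   kernel the ideal of relations. *)
Definition ExtC_presentation (h0 h1 : ExtC 1) (a : ExtC 3) (b : ExtC 4) : Prop :=
  let ev f n := evalC [tuple inC tauC; inC h0; inC h1; inC a; inC b] f n in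
  let tau := var 0 in
  let x0 := var 1 in let x1 := var 2 in let xa := var 3 in let xb := var 4 in
  [/\ [/\ degC 0 0 h0, degC 1 1 h1, degC 4 2 a & degC 8 4 b],
      forall u v : gradedC, gext_mul u v = gext_mul v u,
      forall n (u : ExtC n), exists f, u = ev f n
    & forall f, (forall n, ev f n = 0) <->
        exists q1 q2 q3 q4, f = q1 * (x0 * x1) + q2 * (tau * x1 ^+ 3)
                              + q3 * (x1 * xa) + q4 * (xa ^+ 2 + x0 ^+ 2 * xb)].

(** * The spectral sequence E^- *)

Definition dNC n : {linear cob NC n -> cob NC n.+1} := @cob_d _ psi_NC n.

(* gamma / (rho^j tau^k) has filtration -j, stem j and weight 1 + j + k. *)
Definition filNC_mem (p : int) (x : NC) : Prop :=
  forall j i, monalg.mcoeff (j, i) (x : NCspace) != 0 -> (p <= - j%:Z)%R.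
Definition deg_NC (s w : int) (x : NC) : Prop :=
  forall j i, monalg.mcoeff (j, i) (x : NCspace) != 0 ->
    s = j%:Z /\ w = 1 + j%:Z + i.+1%:Z.

Fixpoint fil_mem (p : int) n : cob NC n -> Prop :=
  match n return cob NC n -> Prop with
  | 0 => filNC_mem p
  | n'.+1 => fun x : {ffun mon -> cob NC n'} => forall m, @fil_mem p n' (x m)
  end.

Lemma fil_mem0 p n : @fil_mem p n 0.
Proof.
elim: n => [|n IHn] /=; first by move=> j i; rewrite monalg.mcoeff0 eqxx.
by move=> m; rewrite ffunE.
Qed.

Lemma fil_memB p n (x y : cob NC n) : fil_mem p x -> fil_mem p y -> fil_mem p (x - y).
Proof.
elim: n x y => [|n IHn] x y /= Fx Fy; last by move=> m; rewrite !ffunE; apply: IHn.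
move=> j i; have [x0|/Fx//] := eqVneq (monalg.mcoeff (j, i) (x : NCspace)) 0.
by rewrite monalg.mcoeffB x0 sub0r oppr_eq0; exact: Fy.
Qed.
Definition fil p n : subgroup (cob NC n) := Subgroup (@fil_mem0 p n) (@fil_memB p n).

(* E_r of filtration -s and cohomological degree n *)
Definition Eminus (r s n : nat) : zmodType := Er dNC fil r s n.
Definition d_ (r s n : nat) (x : Eminus r (r + s) n) : Eminus r s n.+1 := dr x.
Definition clsE (s n : nat) (z : cob NC n) : Eminus 1 s n :=
  cls (Zr dNC fil 1 (- s%:Z) n) (Br dNC fil 1 (- s%:Z) n) z.

Definition degE s n (t w : int) (x : Eminus 1 s n) : Prop :=
  exists z : cob NC n, [/\ Zr dNC fil 1 (- s%:Z) n z, cob_deg deg_NC t w z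
    & x = clsE s z].

(* gamma / (rho^j tau^k) (x) z, for z in a tensor power of A / rho *)
Fixpoint gam_tens (j k n : nat) : cob Ftau n -> cob NC n :=
  match n return cob Ftau n -> cob NC n with
  | 0 => fun p : {poly 'F_2} => tau_eval p (gam j k : NC)
  | n'.+1 => fun x : {ffun mon -> cob Ftau n'} =>
      [ffun m => @gam_tens j k n' (x m)] : {ffun mon -> cob NC n'}
  end.

(* gamma / (rho^j tau^k) y in E_1, for y in Ext_C(1) *)
Definition gamE (j k n : nat) (y : ExtC n) : Eminus 1 j n :=
  clsE j (gam_tens j k (rep y)).

(* The projection E_1 -> Tor_1(F_2[tau]/tau^oo {gamma / rho^s}, Ext_C(1)).
   Computed with the flat resolution F_2[tau] -> F_2[tau, 1/tau] of
   F_2[tau]/tau^oo, this Tor_1 is the subgroup of tau-power torsion elements of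
   Ext_C(1), the submodule F_2[tau]/tau {h1^3} contributing the element h1^3, and
   the projection is the connecting homomorphism of the tensor product of the
   resolution with the cobar complex of A / rho: it sends the class of
   gamma / (rho^s tau^k) (x) c, where d c = tau^k z, to the class of z. *)
Definition Tor_proj s n (x : Eminus 1 s n) (y : ExtC n.+1) : Prop :=
  exists (k : nat) (c : cob Ftau n) (z : cob Ftau n.+1),
    [/\ dC n.+1 z = 0, dC n c = iter k (rt_tau (cob Ftau n.+1)) z,
        x = clsE s (gam_tens s k c) & y = clsC z].

(* x is a lift (Q / rho^s) h1^3, of degree (4 + s, 2, 4 + s), of the element of
   the s-th Tor_1 summand contributed by h1^3. *)
Definition is_Qh1cube (h1 : ExtC 1) s (x : Eminus 1 s 2) : Prop :=
  degE (4 + s)%N%:Z (4 + s)%N%:Z x /\ Tor_proj x (ext_mul h1 (ext_mul h1 h1) : ExtC 3).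

(* Main.v *)
Require Import Defs.
From HB Require Import structures.
From mathcomp Require Import all_boot all_order all_algebra finmap.
From mathcomp Require Import boolp generic_quotient.
From mathcomp Require Import monalg.
From mathcomp Require Import mpoly.
From mathcomp Require Import zify.

Set Implicit Arguments.
Unset Strict Implicit.
Unset Printing Implicit Defensive.

Import Order.TTheory GRing.Theory Num.Theory.
Local Open Scope ring_scope.

(** The first differential is the formula for the coaction of NC: as
    eta_R(tau) = tau + rho tau_0 and gamma / (rho^j tau^(2k+2)) is primitive
    modulo rho^2, the element gamma / (rho^j tau^(2k+1)), which is tau times
    that symbol, has coboundary gamma / (rho^(j-1) tau^(2k+2)) [tau_0] up to
    higher filtration ([d_gam_odd]), and [tau_0] represents h0 because the
    degree of h0 contains nothing else ([h0_eq_tau0]).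

    For the second, put c0 = [xi_1|tau_0 tau_1] + [tau_1|tau_1] +
    [xi_1 tau_1|tau_0].  Modulo rho its coboundary is tau [xi_1|xi_1|xi_1], so
    gamma / (rho^s tau) c0 is a cocycle of the first page that lifts the
    torsion class of h1^3.  Computing its coboundary modulo rho^2 gives
    gamma / (rho^(s-1) tau^2) times an explicit cocycle ([d_c0_form]).  Two
    facts identify both sides with the classes of the statement.  First, every
    class of the first page of the degree of (Q / rho^s) h1^3 is a multiple of
    gamma / (rho^s tau) c0 ([E1_degree_lift]), and it is not zero, since it maps
    to h1^3 under the connecting homomorphism ([Tor_proj_eq0]) and the
    presentation of Ext_C gives h1^3 <> 0 ([h1_cube_neq0]).  Secondly, the
    cohomology of A / rho in the degree of a has dimension at most one and is
    spanned by the explicit cocycle ([cocycle_degree_a]), while a <> 0 by the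
    presentation ([a_class]).

    Both facts are finite linear algebra over F_2.  So are the identities of
    the Hopf algebroid that are needed in general (coassociativity, naturality
    of the coproduct, compatibility with the right unit), because they concern
    finitely many coefficients of one generic element.  Such computations are
    done with formal cochains, whose coefficients are F_2[tau, rho]-linear
    combinations of symbols; evaluating the symbols in any module commutes with
    all operations ([eval_tens_coprod], [eval_d]).

    The differential on the first page does not depend on representatives
    because d d = 0 in the cobar complex of NC ([cob_d_d]).  The coassociativity
    of the coaction, an identity between power series, is avoided: if 2^e > j
    then gamma / (rho^j tau^(2^e)) is primitive by Frobenius, every symbol is a
    tau-multiple of one of these, and the coaction is tau-linear
    ([comodule_NC]). *)

(** * Formal cochains *)

(** Nested tuples stand in for finite functions on mon because they compute. *)
Definition tup (T : Type) : Type := ((T * T) * (T * T)) * ((T * T) * (T * T)).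

Definition mons : seq mon :=
  [:: (false, false, false); (false, false, true);
      (false, true, false); (false, true, true);
      (true, false, false); (true, false, true);
      (true, true, false); (true, true, true)].

Definition get (T : Type) (X : tup T) (m : mon) : T :=
  let: (e0, e1, ex) := m in
  let Y := if e0 then X.2 else X.1 in
  let Z := if e1 then Y.2 else Y.1 in
  if ex then Z.2 else Z.1.

Definition tab (T : Type) (f : mon -> T) : tup T :=
  (((f (false, false, false), f (false, false, true)),
    (f (false, true, false), f (false, true, true))),
   ((f (true, false, false), f (true, false, true)),
    (f (true, true, false), f (true, true, true)))).

Definition tmap (T U : Type) (f : T -> U) (X : tup T) : tup U :=
  tab (fun m => f (get X m)).

(** The operations of an rtmod on a bare type, without laws. In the rest of
    the file the prefix c marks the formal copy of an operation of the cobar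
    complex. *)
Record frtmod : Type := FRTMod {
  ccar :> Type;
  czero : ccar;
  cadd : ccar -> ccar -> ccar;
  crho : ccar -> ccar;
  ctau : ccar -> ccar }.

Section FormalTensor.
Variable C : frtmod.
Local Notation CA := (tup C).

Definition tzero : CA := tab (fun=> czero C).
Definition tadd (X Y : CA) : CA := tab (fun m => cadd (get X m) (get Y m)).
Definition cmul_xi1 (X : CA) : CA :=
  tab (fun m : mon => if m.2 then get X (m.1, false) else czero C).
Definition cmul_tau1 (X : CA) : CA :=
  tab (fun m : mon => if m.1.2 then get X (m.1.1, false, m.2) else czero C).
Definition cfree_tau0 (X : CA) : CA :=
  tab (fun m : mon => if m.1.1 then get X (false, m.1.2, m.2) else czero C).
Definition ccoef_tau0 (X : CA) : CA :=
  tab (fun m : mon => if m.1.1 then czero C else get X (true, m.1.2, m.2)).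
Definition cmul_tau0 (X : CA) : CA :=
  let Z := ccoef_tau0 X in
  tadd (cfree_tau0 X)
    (tadd (tadd (tmap (@crho C) (cmul_tau1 Z)) (tmap (@ctau C) (cmul_xi1 Z)))
          (tmap (@crho C) (cfree_tau0 (cmul_xi1 Z)))).
Definition crho_r (X : CA) : CA := tmap (@crho C) X.
Definition ctau_r (X : CA) : CA :=
  tadd (tmap (@ctau C) X) (tmap (@crho C) (cmul_tau0 X)).
Definition cunit_r (x : C) : CA :=
  tab (fun m : mon => if m == (false, false, false) then x else czero C).
End FormalTensor.

Definition ctens (C : frtmod) : frtmod :=
  @FRTMod (tup C) (tzero C) (@tadd C) (@crho_r C) (@ctau_r C).

Section FormalCoproduct.
Variable C : frtmod.
Local Notation CAA := (ctens (ctens C)).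

Definition cmulD_xi1 (X : CAA) : CAA :=
  cadd (tmap (@cmul_xi1 C) X : CAA) (@cmul_xi1 (ctens C) X).
Definition cmulD_tau1 (X : CAA) : CAA :=
  cadd (cadd (tmap (@cmul_tau1 C) X : CAA)
    (tmap (@cmul_xi1 C) (@cmul_tau0 (ctens C) X) : CAA)) (@cmul_tau1 (ctens C) X).
Definition cmulD_tau0 (X : CAA) : CAA :=
  cadd (tmap (@cmul_tau0 C) X : CAA) (@cmul_tau0 (ctens C) X).
Definition ccoprod (X : ctens C) : CAA :=
  foldr (fun (m : mon) acc => cadd
     (iter m.1.1 cmulD_tau0 (iter m.1.2 cmulD_tau1 (iter m.2 cmulD_xi1
       (cunit_r (cunit_r (get X m) : ctens C))))) acc)
    (czero CAA) mons.
End FormalCoproduct.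

(** Addition of sums over F_2: a list stands for the sum of its entries, and
    an entry that occurs twice cancels. *)
Definition xor_seq (T : eqType) (K L : seq T) : seq T :=
  foldr (fun t acc => if t \in acc then rem t acc else t :: acc) L K.

(** The entry (i, r, v) stands for tau^i rho^r x_v, where x_0, x_1, ... are
    symbols; so a form is an element of the free F_2[tau, rho]-module on
    these symbols. *)
Definition form := seq (nat * nat * nat).
Definition cform : frtmod :=
  @FRTMod form [::] (@xor_seq _) (map (fun t => (t.1.1, t.1.2.+1, t.2)))
    (map (fun t => (t.1.1.+1, t.1.2, t.2))).

Definition formal_cob n : frtmod := iter n ctens cform.

(** The coaction for which every symbol x_v is primitive. All coactions met
    below agree with it up to high enough filtration, and compatibility with
    tau and rho leaves no other choice. *)
Definition formal_psi (L : form) : ctens cform :=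
  foldr (fun t acc => @cadd (ctens cform) (iter t.1.1 (@ctau (ctens cform))
    (iter t.1.2 (@crho (ctens cform)) (@cunit_r cform [:: (0, 0, t.2)%N]))) acc)
      (czero (ctens cform)) L.

Fixpoint formal_inner n : formal_cob n -> formal_cob n.+1 :=
  match n return formal_cob n -> formal_cob n.+1 with
  | 0 => formal_psi
  | n'.+1 => fun X => @cadd (formal_cob n'.+2) (@ccoprod (formal_cob n') X)
    (tmap (@formal_inner n') X)
  end.
Definition formal_d n (X : formal_cob n) : formal_cob n.+1 :=
  @cadd (formal_cob n.+1) (formal_inner X) (cunit_r X).

Fixpoint leaves n : formal_cob n -> seq form :=
  match n return formal_cob n -> seq form with
  | 0 => fun L => [:: L]
  | n'.+1 => fun X => flatten [seq @leaves n' (get X m) | m <- mons]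
  end.

(** The symbol x_v with v = mon_code m is the coefficient of m in the
    generic element of N (x) A. *)
Definition mon_code (m : mon) : nat := (4 * m.1.1 + 2 * m.1.2 + m.2)%N.
Definition generic : formal_cob 1 := tab (fun m => [:: (0, 0, mon_code m)%N]).

Definition mon_decode (v : nat) : mon := nth (false, false, false) mons v.
Lemma mon_codeK m : mon_decode (mon_code m) = m. Proof. by case: m => [[[] []] []]. Qed.
Lemma get_tab (T : Type) (f : mon -> T) m : get (tab f) m = f m.
Proof. by case: m => [[[] []] []]. Qed.

Lemma sum_mons (V : nmodType) (F : mon -> V) : \sum_m F m = \sum_(m <- mons) F m.
Proof.
apply: perm_big; apply: uniq_perm; rewrite ?index_enum_uniq //.
by move=> m; rewrite mem_index_enum; case: m => [[[] []] []].
Qed.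

(** Every identity between natural F_2[tau, rho]-linear operations on N (x)
    A is an identity between finitely many coefficients of one generic
    element, hence a finite computation. *)
Lemma coassoc_check : all (@nilp _) (leaves (@cadd (formal_cob 3)
  (@ccoprod (formal_cob 1) (@ccoprod (formal_cob 0) generic))
    (tmap (@ccoprod (formal_cob 0)) (@ccoprod (formal_cob 0) generic)))).
Proof. by vm_compute. Qed.
Lemma tau_check : all (@nilp _) (leaves (@cadd (formal_cob 2)
  (@ccoprod (formal_cob 0) (@ctau (formal_cob 1) generic))
    (@ctau (formal_cob 2) (@ccoprod (formal_cob 0) generic)))).
Proof. by vm_compute. Qed.

(** * Evaluation of formal cochains *)

Record evaluation (C : frtmod) (N : rtmod) (J : C -> N) : Prop := Evaluation {
  evaluation0 : J (czero C) = 0;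
  evaluationD : forall X Y, J (cadd X Y) = J X + J Y;
  evaluation_rho : forall X, J (crho X) = rt_rho N (J X);
  evaluation_tau : forall X, J (ctau X) = rt_tau N (J X) }.

Definition eval_tens (C : frtmod) (N : rtmod) (J : C -> N) (X : tup C) : tensA N :=
  [ffun m => J (get X m)].

Section EvalTensor.
Variables (C : frtmod) (N : rtmod) (J : C -> N).
Hypothesis hJ : evaluation J.
Local Notation JA := (eval_tens J).

Lemma eval_tens0 : JA (tzero C) = 0.
Proof. by apply/ffunP=> m; rewrite !ffunE get_tab evaluation0. Qed.
Lemma eval_tensD X Y : JA (tadd X Y) = JA X + JA Y.
Proof. by apply/ffunP=> m; rewrite !ffunE get_tab evaluationD. Qed.
Lemma eval_tens_map (C' : frtmod) (N' : rtmod) (J' : C' -> N') (F : C -> C') (f : N -> N') :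
  (forall X, J' (F X) = f (J X)) ->
  forall X, eval_tens J' (tmap F X) = cwise f (JA X).
Proof. by move=> Ff X; apply/ffunP=> m; rewrite !ffunE get_tab Ff. Qed.
Lemma eval_tens_mul_xi1 X : JA (cmul_xi1 X) = mul_xi1 (JA X).
Proof. by apply/ffunP=> m; rewrite !ffunE get_tab; case: ifP; rewrite ?evaluation0. Qed.
Lemma eval_tens_mul_tau1 X : JA (cmul_tau1 X) = mul_tau1 (JA X).
Proof. by apply/ffunP=> m; rewrite !ffunE get_tab; case: ifP; rewrite ?evaluation0. Qed.
Lemma eval_tens_free_tau0 X : JA (cfree_tau0 X) = free_tau0 (JA X).
Proof. by apply/ffunP=> m; rewrite !ffunE get_tab; case: ifP; rewrite ?evaluation0. Qed.
Lemma eval_tens_coef_tau0 X : JA (ccoef_tau0 X) = coef_tau0 (JA X).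
Proof. by apply/ffunP=> m; rewrite !ffunE get_tab; case: ifP; rewrite ?evaluation0. Qed.
Lemma eval_tens_mul_tau0 X : JA (cmul_tau0 X) = mul_tau0 (JA X).
Proof.
rewrite /cmul_tau0 !eval_tensD !(eval_tens_map (evaluation_rho hJ),
  eval_tens_map (evaluation_tau hJ)).
by rewrite !(eval_tens_free_tau0, eval_tens_mul_tau1, eval_tens_mul_xi1,
  eval_tens_coef_tau0).
Qed.
Lemma eval_tens_unit x : JA (cunit_r x) = unit_r (J x).
Proof. by apply/ffunP=> m; rewrite !ffunE get_tab; case: ifP; rewrite ?evaluation0. Qed.

Lemma eval_tensP : @evaluation (ctens C) (tensA N) JA.
Proof.
split; [exact: eval_tens0 | exact: eval_tensD | exact: (eval_tens_map (evaluation_rho hJ))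
  |].
by move=> X; rewrite /= eval_tensD !(eval_tens_map (evaluation_rho hJ),
  eval_tens_map (evaluation_tau hJ)) eval_tens_mul_tau0.
Qed.
End EvalTensor.

Section EvalCoprod.
Variables (C : frtmod) (N : rtmod) (J : C -> N).
Hypothesis hJ : evaluation J.
Let hJA := eval_tensP hJ.
Local Notation JAA := (@eval_tens (ctens C) (tensA N) (eval_tens J)).

Let eval_tens_mapA := @eval_tens_map (ctens C) (tensA N) (eval_tens J) (ctens C) (tensA N)
  (eval_tens J).

Lemma eval_tens_mulD_xi1 X : JAA (cmulD_xi1 X) = mulD_xi1 (JAA X).
Proof.
rewrite /cmulD_xi1 eval_tensD // (eval_tens_mapA (eval_tens_mul_xi1 hJ)).
by rewrite eval_tens_mul_xi1.
Qed.
Lemma eval_tens_mulD_tau1 X : JAA (cmulD_tau1 X) = mulD_tau1 (JAA X).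
Proof.
rewrite /cmulD_tau1 !eval_tensD // (eval_tens_mapA (eval_tens_mul_xi1 hJ))
  (eval_tens_mapA (eval_tens_mul_tau1 hJ)).
by rewrite eval_tens_mul_tau0 // eval_tens_mul_tau1.
Qed.
Lemma eval_tens_mulD_tau0 X : JAA (cmulD_tau0 X) = mulD_tau0 (JAA X).
Proof.
rewrite /cmulD_tau0 eval_tensD // (eval_tens_mapA (eval_tens_mul_tau0 hJ)).
by rewrite eval_tens_mul_tau0.
Qed.
Lemma iter_intertwine (T U : Type) (h : T -> U) (F : T -> T) (f : U -> U) k X :
  (forall X, h (F X) = f (h X)) -> h (iter k F X) = iter k f (h X).
Proof. by move=> Ff; elim: k => //= k <-. Qed.

(** All operations on N (x) A and N (x) A (x) A are built from rho, tau and
    additions on coefficients, so they commute with evaluation; this is what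
    makes computations with formal cochains valid in every module. *)
Lemma eval_tens_coprod X : JAA (ccoprod X) = coprod (eval_tens J X).
Proof.
rewrite /coprod sum_mons /ccoprod; elim: mons => [|m s IHs].
  by rewrite big_nil /=; apply: (eval_tens0 hJA).
rewrite big_cons /= -IHs (eval_tensD hJA); congr (_ + _).
rewrite (iter_intertwine _ _ eval_tens_mulD_tau0)
  (iter_intertwine _ _ eval_tens_mulD_tau1) (iter_intertwine _ _ eval_tens_mulD_xi1).
by rewrite (eval_tens_unit hJA) eval_tens_unit // ffunE.
Qed.
End EvalCoprod.

Lemma addxx (V : lmodType 'F_2) (x : V) : x + x = 0.
Proof. by rewrite -[x]scale1r -scalerDl; have -> : 1 + 1 = 0 :> 'F_2;
  [exact/val_inj | rewrite scale0r]. Qed.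
Lemma oppx (V : lmodType 'F_2) (x : V) : - x = x.
Proof. by apply/eqP; rewrite eq_sym -addr_eq0 addxx. Qed.

Lemma sum_xor_seq (T : eqType) (V : lmodType 'F_2) (F : T -> V) (K L : seq T) :
  \sum_(t <- xor_seq K L) F t = \sum_(t <- K) F t + \sum_(t <- L) F t.
Proof.
elim: K => [|t K IHK] /=; first by rewrite big_nil add0r.
rewrite big_cons -addrA -IHK; case: ifP => [tL|_]; last by rewrite big_cons.
by rewrite [in RHS](big_rem _ tL) /= addrA addxx add0r.
Qed.

(** * Stable subgroups, congruences and naturality *)

Record stable (N : rtmod) (P : N -> Prop) : Prop := Stable {
  stable0 : P 0;
  stableD : forall x y, P x -> P y -> P (x + y);
  stable_rho : forall x, P x -> P (rt_rho N x);
  stable_tau : forall x, P x -> P (rt_tau N x) }.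

(** The cochains with all coefficients in P. For P a step of the filtration
    of NC this is the filtration of the cobar complex. *)
Fixpoint liftn (N : rtmod) (P : N -> Prop) n : cob N n -> Prop :=
  match n return cob N n -> Prop with
  | 0 => P
  | n'.+1 => fun x : {ffun mon -> cob N n'} => forall m, liftn P (x m)
  end.

Fixpoint cobmap (N N' : rtmod) (f : N -> N') n : cob N n -> cob N' n :=
  match n return cob N n -> cob N' n with
  | 0 => f
  | n'.+1 => cwise (@cobmap N N' f n')
  end.

Section EvalForms.
Variables (N : rtmod) (val : nat -> N).

(** The value of a form for a choice val v of elements of N for the symbols. *)
Definition eval_term (t : nat * nat * nat) : N :=
  iter t.1.1 (rt_tau N) (iter t.1.2 (rt_rho N) (val t.2)).
Definition eval_form (L : cform) : N := \sum_(t <- (L : seq _)) eval_term t.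

Lemma iter_comm (T : Type) (f g : T -> T) k x :
  (forall x, f (g x) = g (f x)) -> iter k f (g x) = g (iter k f x).
Proof. by move=> fg; elim: k => //= k ->. Qed.

Lemma eval_formP : evaluation eval_form.
Proof.
split; [by rewrite /eval_form big_nil | exact: sum_xor_seq | |] => L.
  rewrite /eval_form big_map raddf_sum; apply: eq_bigr => t _.
  by rewrite /eval_term /= iter_comm // => x; rewrite rt_comm.
by rewrite /eval_form big_map raddf_sum; apply: eq_bigr.
Qed.

Fixpoint eval_chain n : formal_cob n -> cob N n :=
  match n return formal_cob n -> cob N n with
  | 0 => eval_form
  | n'.+1 => eval_tens (@eval_chain n')
  end.
Lemma eval_chainP n : evaluation (@eval_chain n).
Proof. by elim: n => [|n IHn]; [exact: eval_formP | exact: eval_tensP]. Qed.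

Lemma eval_chain_leaves (P : N -> Prop) n (X : formal_cob n) :
  (forall L, L \in leaves X -> P (eval_form L)) -> liftn P (eval_chain X).
Proof.
elim: n X => [|n IHn] X PX; first by apply: PX; rewrite mem_seq1.
move=> m; rewrite ffunE; apply: IHn => L LX; apply: PX.
apply/flatten_mapP; exists m => //; by case: m {LX} => [[[] []] []].
Qed.

Lemma leaves_eval_chain (P : N -> Prop) n (X : formal_cob n) :
  liftn P (eval_chain X) -> forall L, L \in leaves X -> P (eval_form L).
Proof.
elim: n X => [|n IHn] X PX L; first by rewrite mem_seq1 => /eqP ->.
by case/flatten_mapP => m _; apply: IHn; have := PX m; rewrite ffunE.
Qed.
End EvalForms.

Lemma liftn_eq0 (N : rtmod) n (x : cob N n) : liftn (fun y => y = 0) x -> x = 0.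
Proof.
by elim: n x => // n IHn x x0; apply/ffunP=> m; rewrite ffunE; apply/IHn/x0.
Qed.

Lemma nil_leaves (N : rtmod) (val : nat -> N) n (X : formal_cob n) :
  all (@nilp _) (leaves X) -> eval_chain val X = 0.
Proof.
move=> /allP X0; apply/liftn_eq0/eval_chain_leaves => L /X0 /nilP ->.
by rewrite /eval_form big_nil.
Qed.

Lemma eval_chain_eq (N : rtmod) (val : nat -> N) n (X Y : formal_cob n) :
  all (@nilp _) (leaves (cadd X Y)) -> eval_chain val X = eval_chain val Y.
Proof.
move/(nil_leaves val); rewrite (evaluationD (eval_chainP val n)) => /eqP.
by rewrite addr_eq0 oppx => /eqP.
Qed.

(** With these values the generic element becomes x. *)
Definition generic_val (N : rtmod) (x : tensA N) (v : nat) : N :=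
  (x : {ffun mon -> N}) (mon_decode v).
Lemma eval_generic (N : rtmod) (x : tensA N) : @eval_chain N (generic_val x) 1 generic = x.
Proof.
apply/ffunP=> m; rewrite ffunE get_tab /= /eval_form big_cons big_nil addr0.
by rewrite /eval_term /= /generic_val mon_codeK.
Qed.

Section Generic.
Variable N : rtmod.
Implicit Type x : tensA N.
Lemma tau_generic x : rt_tau (tensA N) x = @eval_chain N (generic_val x) 1
  (@ctau (formal_cob 1) generic).
Proof. by rewrite (evaluation_tau (eval_chainP _ 1)) eval_generic. Qed.
Lemma coprod_generic x : coprod x = @eval_chain N (generic_val x) 2
  (@ccoprod (formal_cob 0) generic).
Proof. by rewrite -[in LHS](eval_generic x);
  exact/esym/(eval_tens_coprod (eval_formP _)). Qed.

Lemma coprod_tau x : coprod (rt_tau (tensA N) x) = rt_tau (tensA (tensA N)) (coprod x).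
Proof.
transitivity (@eval_chain N (generic_val x) 2
  (@ccoprod (formal_cob 0) (@ctau (formal_cob 1) generic))).
  by rewrite tau_generic; exact/esym/(eval_tens_coprod (eval_formP _)).
transitivity (@eval_chain N (generic_val x) 2
  (@ctau (formal_cob 2) (@ccoprod (formal_cob 0) generic))).
  by apply: (@eval_chain_eq N (generic_val x) 2); exact: tau_check.
by rewrite coprod_generic; exact: (evaluation_tau (eval_chainP _ 2)).
Qed.

(** Both sides are evaluations, at the coefficients of x, of formal cochains
    whose equality is checked by computation. *)
Lemma coprod_coassoc x : coprod (coprod x) = cwise (@coprod N) (coprod x).
Proof.
transitivity (@eval_chain N (generic_val x) 3
  (@ccoprod (formal_cob 1) (@ccoprod (formal_cob 0) generic))).
  by rewrite [in LHS]coprod_generic; exact/esym/(eval_tens_coprod (eval_chainP _ 1)).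
transitivity (@eval_chain N (generic_val x) 3
  (tmap (@ccoprod (formal_cob 0)) (@ccoprod (formal_cob 0) generic))).
  by apply: (@eval_chain_eq N (generic_val x) 3); exact: coassoc_check.
rewrite [in RHS]coprod_generic.
apply: (@eval_tens_map _ _ (@eval_chain N (generic_val x) 1) _ _
  (@eval_chain N (generic_val x) 2) (@ccoprod (formal_cob 0))).
exact: (eval_tens_coprod (eval_formP (generic_val x))).
Qed.

Variable P : N -> Prop.
Hypothesis PP : stable P.
Lemma stable_eval_form val L : (forall v, P (val v)) -> P (@eval_form N val L).
Proof.
move=> Pv; rewrite /eval_form; elim/big_ind: _ => [||t _].
- exact: stable0.
- by move=> x y; exact: stableD.
rewrite /eval_term; elim: t.1.1 => [|i IHi] /=; last exact: stable_tau.
by elim: t.1.2 => [|i IHi] //=; exact: stable_rho.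
Qed.
Lemma stable_eval_chain val n X : (forall v, P (val v)) -> liftn P (@eval_chain N val n X).
Proof. by move=> Pv; apply: eval_chain_leaves => L _; exact: stable_eval_form. Qed.

Lemma stable_lift : stable (fun x : tensA N => forall m, P ((x : {ffun mon -> N}) m)).
Proof.
split=> [m|x y Px Py m|x Px m|x Px].
- by rewrite ffunE; exact: stable0.
- by rewrite ffunE; exact: stableD.
- by rewrite ffunE; exact: stable_rho.
by rewrite tau_generic; apply: (@stable_eval_chain _ 1) => v; exact: Px.
Qed.

(** The coefficients of coprod x are F_2[tau, rho]-combinations of those of
    x. *)
Lemma stable_coprod x : (forall m, P ((x : {ffun mon -> N}) m)) -> @liftn N P 2 (coprod x).
Proof. by move=> Px; rewrite coprod_generic; apply: (@stable_eval_chain _ 2) => v;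
  exact: Px. Qed.
Lemma stable_unit (y : N) : P y -> forall m, P ((@unit_r N y : {ffun mon -> N}) m).
Proof. by move=> Py m; rewrite ffunE; case: ifP => _ //; exact: stable0. Qed.
End Generic.

Lemma stable_liftn (N : rtmod) (P : N -> Prop) n : stable P -> stable (@liftn N P n).
Proof. by move=> PP; elim: n => [|n IHn] //; exact: (stable_lift IHn). Qed.

Lemma stable_eq0 (N : rtmod) : stable (fun y : N => y = 0).
Proof. by split=> // [x y -> ->|x ->|x ->]; rewrite ?raddf0 ?addr0. Qed.

(** Congruences are used instead of quotient complexes: working modulo a
    step of the filtration then needs no new module. *)
Definition eq_mod (N : rtmod) (P : N -> Prop) (x y : N) : Prop := P (x - y).
Section Congruence.
Variables (N : rtmod) (P : N -> Prop).
Hypothesis PP : stable P.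
Lemma eq_mod_refl x : eq_mod P x x. Proof. by rewrite /eq_mod subrr; exact: stable0. Qed.
Lemma eq_mod_sym x y : eq_mod P x y -> eq_mod P y x.
Proof. by rewrite /eq_mod -[y - x]opprB [- (x - y)]oppx. Qed.
Lemma eq_mod_trans y x z : eq_mod P x y -> eq_mod P y z -> eq_mod P x z.
Proof. by rewrite /eq_mod => xy yz; rewrite -[x](subrK y) -addrA; exact: stableD. Qed.
Lemma eq_modD x y x' y' : eq_mod P x y -> eq_mod P x' y' -> eq_mod P (x + x') (y + y').
Proof. by rewrite /eq_mod => xy xy'; rewrite opprD addrACA; exact: stableD. Qed.
Lemma eq_mod_rho x y : eq_mod P x y -> eq_mod P (rt_rho N x) (rt_rho N y).
Proof. by rewrite /eq_mod -raddfB; exact: stable_rho. Qed.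
Lemma eq_mod_tau x y : eq_mod P x y -> eq_mod P (rt_tau N x) (rt_tau N y).
Proof. by rewrite /eq_mod -raddfB; exact: stable_tau. Qed.
Lemma eq_mod0 x : eq_mod P x 0 <-> P x. Proof. by rewrite /eq_mod subr0. Qed.
Lemma eq_mod_mem x y : eq_mod P x y -> P y -> P x.
Proof. by rewrite /eq_mod => xy Py; rewrite -[x](subrK y); exact: stableD. Qed.
End Congruence.

Lemma eq_mod_cell (N : rtmod) (P : N -> Prop) n (x y : cob N n.+1) :
  (forall m, eq_mod (@liftn N P n) ((x : {ffun mon -> cob N n}) m)
    ((y : {ffun mon -> cob N n}) m)) ->
  eq_mod (@liftn N P n.+1) x y.
Proof. by move=> xy m; rewrite !ffunE; exact: xy. Qed.

(** Multiplication by gamma / (rho^j tau^k) is F_2[tau]-linear, but it is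
    rho-linear only modulo a step of the filtration; hence morphisms modulo
    P. *)
Record morph (N N' : rtmod) (P : N' -> Prop) (f : N -> N') : Prop := Morph {
  morphD : forall x y, f (x + y) = f x + f y;
  morph_rho : forall x, eq_mod P (f (rt_rho N x)) (rt_rho N' (f x));
  morph_tau : forall x, eq_mod P (f (rt_tau N x)) (rt_tau N' (f x)) }.

Section Naturality.
Variables (N N' : rtmod) (P : N' -> Prop) (f : N -> N').
Hypotheses (PP : stable P) (Mf : morph P f).

Lemma morph0 : f 0 = 0.
Proof. by apply: (addrI (f 0)); rewrite -(morphD Mf) !addr0. Qed.

Lemma morph_eval_form val L : eq_mod P (f (eval_form val L)) (eval_form (f \o val) L).
Proof.
rewrite /eval_form; elim: L => [|t L IHL].
  by rewrite !big_nil morph0; exact: eq_mod_refl.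
rewrite !big_cons (morphD Mf); apply: eq_modD => //; rewrite /eval_term.
elim: t.1.1 => [|i IHi] /=; last first.
  by apply: (eq_mod_trans PP (morph_tau Mf _)); exact: eq_mod_tau.
elim: t.1.2 => [|i IHi] /=; first exact: (eq_mod_refl PP).
by apply: (eq_mod_trans PP (morph_rho Mf _)); exact: eq_mod_rho.
Qed.

Lemma morph_eval_chain val n X :
  eq_mod (@liftn N' P n) (cobmap f (@eval_chain N val n X)) (eval_chain (f \o val) X).
Proof.
elim: n X => [|n IHn] X; first exact: morph_eval_form.
by apply: (@eq_mod_cell N' P n) => m; rewrite !ffunE; exact: IHn.
Qed.

Lemma eval_generic_map (x : tensA N) : @eval_chain N' (f \o generic_val x) 1 generic =
  cwise f x.
Proof.
rewrite -[in RHS](eval_generic x); apply/ffunP=> m; rewrite !ffunE get_tab /=.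
by rewrite /eval_form !big_cons !big_nil !addr0.
Qed.

Lemma morph_cwise :
  morph (fun x : tensA N' => forall m, P ((x : {ffun mon -> N'}) m))
    (cwise f : tensA N -> tensA N').
Proof.
split=> [x y|x m|x].
- by apply/ffunP=> m; rewrite !ffunE (morphD Mf).
- by rewrite !ffunE; exact: (morph_rho Mf).
have := @morph_eval_chain (generic_val x) 1 (@ctau (formal_cob 1) generic).
by rewrite (evaluation_tau (eval_chainP (f \o generic_val x) 1)) eval_generic_map
  tau_generic.
Qed.

(** The coefficients of coprod x are combinations of those of x that depend
    on neither x nor the module, so a map that is linear modulo P commutes
    with coprod modulo P. *)
Lemma coprod_natural (x : tensA N) :
  eq_mod (@liftn N' P 2) (coprod (cwise f x : tensA N')) (cwise (cwise f) (coprod x)).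
Proof.
have E : coprod (cwise f x : tensA N') = @eval_chain N' (f \o generic_val x) 2
  (@ccoprod (formal_cob 0) generic).
  by rewrite -eval_generic_map; exact/esym/(eval_tens_coprod (eval_formP _)).
by rewrite E coprod_generic; apply: (@eq_mod_sym (cob N' 2) (@liftn N' P 2));
  exact: (@morph_eval_chain _ 2).
Qed.
End Naturality.

Lemma morph_cobmap (N N' : rtmod) (P : N' -> Prop) (f : N -> N') n :
  stable P -> morph P f -> morph (@liftn N' P n) (@cobmap N N' f n).
Proof.
move=> PP Mf; elim: n => [|n IHn] //=; exact: (morph_cwise (stable_liftn n PP) IHn).
Qed.

(** * The cobar differential *)

Lemma eq_mod_eq0 (N : rtmod) (x y : N) : eq_mod (fun z => z = 0) x y <-> x = y.
Proof. by rewrite /eq_mod; split=> [/eqP|->]; rewrite ?subrr // subr_eq0 => /eqP. Qed.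

Lemma morph_rt_rho (N : rtmod) : morph (fun z : N => z = 0) (rt_rho N).
Proof.
by split=> [x y|x|x]; rewrite ?raddfD //; apply/eq_mod_eq0; rewrite ?rt_comm.
Qed.

(** The coaction is linear for the right unit and coassociative; this is
    what d d = 0 rests on. *)
Record comodule (N : rtmod) (psi : {linear N -> tensA N}) : Prop := Comodule {
  comodule_rho : forall x, psi (rt_rho N x) = rt_rho (tensA N) (psi x);
  comodule_tau : forall x, psi (rt_tau N x) = rt_tau (tensA N) (psi x);
  comodule_coassoc : forall x,
    coprod (psi x) = cwise psi (psi x) :> tensA (tensA N) }.

Lemma coprod_natural_eq (N N' : rtmod) (f : N -> N') : morph (fun z => z = 0) f ->
  forall x : tensA N, coprod (cwise f x : tensA N') = cwise (cwise f) (coprod x).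
Proof.
move=> Mf x; apply/(@eq_mod_eq0 (tensA (tensA N')))/(@liftn_eq0 N' 2).
exact: (coprod_natural (stable_eq0 N') Mf).
Qed.

Section Cobar.
Variables (N : rtmod) (psi : {linear N -> tensA N}).
Hypothesis co : comodule psi.

Lemma morph_inner n : morph (fun z => z = 0) (@cob_inner N psi n).
Proof.
elim: n => [|n IHn].
  split=> [x y|x|x]; first exact: raddfD.
    by apply/(@eq_mod_eq0 (tensA N)); exact: comodule_rho.
  by apply/(@eq_mod_eq0 (tensA N)); exact: comodule_tau.
have MI := morph_cwise (stable_eq0 _) IHn.
split=> [x y|x|x]; first exact: raddfD.
- apply/(@eq_mod_eq0 (cob N n.+2)); rewrite [RHS]raddfD; congr (_ + _).
    exact: (coprod_natural_eq (morph_rt_rho (cob N n))).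
  by apply/(@eq_mod_eq0 (cob N n.+2))/(@liftn_eq0 (cob N n.+1) 1); exact: (morph_rho MI).
apply/(@eq_mod_eq0 (cob N n.+2)); rewrite [RHS]raddfD; congr (_ + _).
  exact: coprod_tau.
by apply/(@eq_mod_eq0 (cob N n.+2))/(@liftn_eq0 (cob N n.+1) 1); exact: (morph_tau MI).
Qed.

Lemma innerS n (x : cob N n.+1) :
  cob_inner psi x = (coprod x : cob N n.+2) + cwise (@cob_inner N psi n) x.
Proof. by []. Qed.
Lemma cob_dE n (x : cob N n) : cob_d psi x = cob_inner psi x + (unit_r x : cob N n.+1).
Proof. by []. Qed.

(** The cosimplicial identities of the inner cofaces, by induction on the
    cobar degree: coassociativity of coprod cancels the two terms made of
    coproducts, naturality of coprod with respect to cob_inner cancels the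
    two mixed terms, and coassociativity of psi starts the induction. *)
Lemma inner_inner n (x : cob N n) : cob_inner psi (cob_inner psi x) = 0.
Proof.
elim: n x => [|n IHn] x.
  by rewrite innerS [coprod _](comodule_coassoc co) addxx.
pose I1 := @cob_inner N psi n; pose I2 := @cob_inner N psi n.+1.
have -> : cob_inner psi (cob_inner psi x) =
    ((coprod (coprod x) : cob N n.+3) + cwise I2 (coprod x))
    + ((coprod (cwise I1 x : cob N n.+2) : cob N n.+3) + cwise I2 (cwise I1 x)).
  by rewrite (innerS x) raddfD.
have -> : cwise I2 (cwise I1 x) = 0 :> {ffun mon -> cob N n.+2}.
  by apply/ffunP=> m; rewrite !ffunE; exact: IHn.
have -> : coprod (cwise I1 x : tensA (cob N n.+1)) = cwise (cwise I1) (coprod x).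
  exact: (coprod_natural_eq (morph_inner n)).
rewrite coprod_coassoc.
rewrite addr0.
have -> : cwise I2 (coprod x)
   = (cwise (@coprod (cob N n)) (coprod x) : cob N n.+3) + cwise (cwise I1) (coprod x).
  by apply/ffunP=> m; rewrite !ffunE.
by rewrite addrA [_ + _ + cwise _ _]addrAC addxx add0r addxx.
Qed.

Lemma cwise_unit (M M' : rtmod) (f : M -> M') (y : M) : f 0 = 0 ->
  cwise f (@unit_r M y) = @unit_r M' (f y).
Proof. by move=> f0; apply/ffunP=> m; rewrite !ffunE; case: ifP. Qed.

Lemma coprod_unit (M : rtmod) (y : M) :
  coprod (unit_r y : tensA M) = unit_r (unit_r y : tensA M).
Proof.
pose c : cform := [:: (0, 0, 0)%N]; pose J := @eval_form M (fun=> y).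
have Jc : J c = y by rewrite /J /eval_form big_cons big_nil addr0.
have E : unit_r y = eval_tens J (cunit_r c) by rewrite eval_tens_unit ?Jc //;
  exact: eval_formP.
transitivity (@eval_chain M (fun=> y) 2 (@ccoprod (formal_cob 0) (cunit_r c))).
  by rewrite E; exact/esym/(eval_tens_coprod (eval_formP _)).
transitivity (@eval_chain M (fun=> y) 2
  (@cunit_r (formal_cob 1) (@cunit_r (formal_cob 0) c))).
  by apply: (@eval_chain_eq M _ 2).
by rewrite E; exact: (eval_tens_unit (eval_chainP _ 1)).
Qed.

Lemma cob_d_d n (x : cob N n) : cob_d psi (cob_d psi x) = 0.
Proof.
have -> : cob_d psi (cob_d psi x) =
    (cob_inner psi (cob_inner psi x) + cob_inner psi (unit_r x : cob N n.+1))
    + ((unit_r (cob_inner psi x) : cob N n.+2) +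
      (unit_r (unit_r x : cob N n.+1) : cob N n.+2)).
  by rewrite (cob_dE x) cob_dE raddfD [unit_r (_ + _)]raddfD.
rewrite inner_inner add0r.
have -> : cob_inner psi (unit_r x : cob N n.+1) =
    (unit_r (unit_r x : cob N n.+1) : cob N n.+2) + (unit_r (cob_inner psi x) : cob N n.+2).
  rewrite (@innerS n (unit_r x)) coprod_unit; congr (_ + _).
  by rewrite cwise_unit // raddf0.
by rewrite [X in _ + X]addrC addxx.
Qed.

Variable P : N -> Prop.
Hypothesis PP : stable P.

Section Preserve.
Hypothesis psiP : forall x, P x -> @liftn N P 1 (psi x).
Lemma stable_inner n (x : cob N n) : liftn P x -> liftn P (cob_inner psi x).
Proof.
elim: n x => [|n IHn] x Px; first exact: psiP.
rewrite innerS; apply: (stableD (stable_liftn n.+2 PP)).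
  exact: (stable_coprod (stable_liftn n PP) Px).
by move=> m; rewrite ffunE; apply/IHn/Px.
Qed.
Lemma stable_d n (x : cob N n) : liftn P x -> liftn P (cob_d psi x).
Proof.
move=> Px; rewrite cob_dE; apply: (stableD (stable_liftn n.+1 PP));
  first exact: stable_inner.
exact: (stable_unit (stable_liftn n PP) Px).
Qed.
End Preserve.

Section Formal.
Variable val : nat -> N.
Hypothesis valP : forall v, eq_mod (@liftn N P 1) (psi (val v)) (unit_r (val v)).
Lemma eval_psi L : eq_mod (@liftn N P 1) (psi (eval_form val L))
  (@eval_chain N val 1 (formal_psi L)).
Proof.
have S1 := stable_liftn 1 PP; have I1 := eval_chainP val 1.
rewrite /eval_form; elim: L => [|t L IHL].
  by rewrite big_nil raddf0 (evaluation0 I1); exact: (eq_mod_refl S1).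
rewrite big_cons raddfD [formal_psi _]/= (evaluationD I1); apply: (eq_modD S1) IHL.
rewrite /eval_term; elim: t.1.1 => [|i IHi] /=; last first.
  rewrite (comodule_tau co).
  exact: (eq_ind_r (eq_mod _ _) (eq_mod_tau S1 IHi) (evaluation_tau I1 _)).
elim: t.1.2 => [|i IHi] /=; last first.
  rewrite (comodule_rho co).
  exact: (eq_ind_r (eq_mod _ _) (eq_mod_rho S1 IHi) (evaluation_rho I1 _)).
have -> : eval_tens (eval_form val) (@cunit_r cform [:: (0, 0, t.2)%N]) = unit_r (val t.2).
  by rewrite (eval_tens_unit (eval_formP val)) /eval_form big_cons big_nil addr0.
exact: valP.
Qed.

Lemma eval_inner n (X : formal_cob n) :
  eq_mod (@liftn N P n.+1) (cob_inner psi (eval_chain val X))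
    (@eval_chain N val n.+1 (formal_inner X)).
Proof.
elim: n X => [|n IHn] X; first exact: eval_psi.
rewrite (evaluationD (eval_chainP val n.+2)) innerS.
apply: (eq_modD (stable_liftn n.+2 PP)).
  have -> : @eval_chain N val n.+2 (@ccoprod (formal_cob n) X) = coprod
    (@eval_chain N val n.+1 X).
    exact: (eval_tens_coprod (eval_chainP val n)).
  exact: (eq_mod_refl (stable_liftn n.+2 PP)).
by apply: (@eq_mod_cell N P n.+1) => m; rewrite !ffunE get_tab; exact: IHn.
Qed.

(** The differential may be computed on formal cochains, modulo P, as soon
    as the values of the symbols are primitive modulo P. *)
Lemma eval_d n (X : formal_cob n) :
  eq_mod (@liftn N P n.+1) (cob_d psi (eval_chain val X))
    (@eval_chain N val n.+1 (formal_d X)).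
Proof.
rewrite (evaluationD (eval_chainP val n.+1)); apply: (eq_modD (stable_liftn n.+1 PP)).
  exact: eval_inner.
have -> : @eval_chain N val n.+1 (cunit_r X) = unit_r (eval_chain val X).
  exact: (eval_tens_unit (eval_chainP val n)).
exact: (eq_mod_refl (stable_liftn n.+1 PP)).
Qed.
End Formal.
End Cobar.

Section CobarMap.
Variables (N N' : rtmod) (psi : {linear N -> tensA N}) (psi' : {linear N' -> tensA N'}).
Variables (P : N' -> Prop) (f : N -> N').
Hypotheses (PP : stable P) (Mf : morph P f).
Hypothesis psif : forall x, eq_mod (@liftn N' P 1) (psi' (f x)) (cwise f (psi x)).

Lemma cobmap_inner n (x : cob N n) :
  eq_mod (@liftn N' P n.+1) (cob_inner psi' (cobmap f x))
    (@cobmap N N' f n.+1 (cob_inner psi x)).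
Proof.
elim: n x => [|n IHn] x; first exact: psif.
have Mn := morph_cobmap n PP Mf.
rewrite (morphD (morph_cobmap n.+2 PP Mf)) innerS.
apply: (eq_modD (stable_liftn n.+2 PP)).
  exact: (coprod_natural (stable_liftn n PP) Mn).
by apply: (@eq_mod_cell N' P n.+1) => m; rewrite !ffunE; exact: IHn.
Qed.

(** A map of modules that is a map of comodules modulo P induces a map of
    cobar complexes modulo P. *)
Lemma cobmap_d n (x : cob N n) :
  eq_mod (@liftn N' P n.+1) (cob_d psi' (cobmap f x)) (@cobmap N N' f n.+1 (cob_d psi x)).
Proof.
rewrite !cob_dE (morphD (morph_cobmap n.+1 PP Mf)).
apply: (eq_modD (stable_liftn n.+1 PP)); first exact: cobmap_inner.
have -> : @cobmap N N' f n.+1 (unit_r x) = unit_r (cobmap f x).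
  exact: (cwise_unit _ (morph0 (morph_cobmap n PP Mf))).
exact: (eq_mod_refl (stable_liftn n.+1 PP)).
Qed.
End CobarMap.

(** * The comodule NC *)

Lemma mul_tau0_generic (N : rtmod) (x : tensA N) :
  mul_tau0 x = @eval_chain N (generic_val x) 1 (@cmul_tau0 cform generic).
Proof.
by rewrite -[in LHS](eval_generic x); exact/esym/(eval_tens_mul_tau0 (eval_formP _)).
Qed.

Lemma tau_mul_tau0_check : all (@nilp _) (leaves (@cadd (formal_cob 1)
  (@ctau (formal_cob 1) (@cmul_tau0 cform generic))
    (@cmul_tau0 cform (@ctau (formal_cob 1) generic)))).
Proof. by vm_compute. Qed.
Lemma tau_mul_tau0 (N : rtmod) (x : tensA N) : tau_r (mul_tau0 x) = mul_tau0 (tau_r x).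
Proof.
pose J := @eval_chain N (generic_val x) 1.
transitivity (J (@ctau (formal_cob 1) (@cmul_tau0 cform generic))).
  by rewrite mul_tau0_generic; exact/esym/(evaluation_tau (eval_chainP _ 1)).
transitivity (J (@cmul_tau0 cform (@ctau (formal_cob 1) generic))).
  by apply: (@eval_chain_eq N _ 1); exact: tau_mul_tau0_check.
by rewrite [tau_r x]tau_generic; exact: (eval_tens_mul_tau0 (eval_formP _)).
Qed.

Lemma rho_mul_tau0_check : all (@nilp _) (leaves (@cadd (formal_cob 1)
  (@crho (formal_cob 1) (@cmul_tau0 cform generic))
    (@cmul_tau0 cform (@crho (formal_cob 1) generic)))).
Proof. by vm_compute. Qed.
Lemma rho_mul_tau0 (N : rtmod) (x : tensA N) : rho_r (mul_tau0 x) = mul_tau0 (rho_r x).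
Proof.
pose J := @eval_chain N (generic_val x) 1.
transitivity (J (@crho (formal_cob 1) (@cmul_tau0 cform generic))).
  by rewrite mul_tau0_generic; exact/esym/(evaluation_rho (eval_chainP _ 1)).
transitivity (J (@cmul_tau0 cform (@crho (formal_cob 1) generic))).
  by apply: (@eval_chain_eq N _ 1); exact: rho_mul_tau0_check.
have -> : rho_r x = eval_tens (eval_form (generic_val x)) (@crho (formal_cob 1) generic).
  by rewrite -[in LHS](eval_generic x); exact/esym/(evaluation_rho (eval_chainP _ 1)).
exact: (eval_tens_mul_tau0 (eval_formP _)).
Qed.

Lemma tau_sqr_check : all (@nilp _) (leaves (@cadd (formal_cob 1)
  (@ctau (formal_cob 1) (@ctau (formal_cob 1) generic))
  (@cadd (formal_cob 1) (tmap (@ctau cform) (tmap (@ctau cform) generic))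
     (@crho (formal_cob 1) (@crho (formal_cob 1)
       (@cmul_tau0 cform (@cmul_tau0 cform generic))))))).
Proof. by vm_compute. Qed.

(** This is (tau + rho tau_0)^2 = tau^2 + rho^2 tau_0^2, the source of all
    congruences modulo rho^2 below. *)
Lemma tau_r_sqr (N : rtmod) (x : tensA N) :
  tau_r (tau_r x) = cwise (rt_tau N) (cwise (rt_tau N) x) + rho_r
    (rho_r (mul_tau0 (mul_tau0 x))).
Proof.
pose J := @eval_chain N (generic_val x) 1; have hJ : evaluation J := eval_chainP _ 1.
have h0 := eval_formP (generic_val x).
transitivity (J (@ctau (formal_cob 1) (@ctau (formal_cob 1) generic))).
  by rewrite [tau_r x]tau_generic; exact/esym/(evaluation_tau hJ).
rewrite [LHS](@eval_chain_eq N _ 1 _ _ tau_sqr_check) -/J.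
rewrite (evaluationD hJ) !(evaluation_rho hJ); congr (_ + rho_r (rho_r _)).
  rewrite /J /= !(eval_tens_map (evaluation_tau h0)); congr (cwise _ (cwise _ _));
    exact: eval_generic.
rewrite /J /= !(eval_tens_mul_tau0 h0); congr (mul_tau0 (mul_tau0 _)); exact: eval_generic.
Qed.

Lemma tau_r_unit (N : rtmod) (y : N) :
  tau_r (unit_r y) = unit_r (rt_tau N y) + mul_tau0 (unit_r (rt_rho N y)).
Proof.
rewrite /tau_r (cwise_unit y (raddf0 (rt_tau N))); congr (_ + _).
rewrite -/(rho_r _) [LHS]rho_mul_tau0; congr mul_tau0.
exact: (cwise_unit y (raddf0 (rt_rho N))).
Qed.

Lemma F2P (c : 'F_2) : c = 0 \/ c = 1.
Proof. by case: c => [[|[|//]] ltc]; [left | right]; apply/val_inj. Qed.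

Lemma oppF2 (c : 'F_2) : - c = c.
Proof. by case: (F2P c) => ->; apply/val_inj. Qed.

Lemma mcoeff_gam j i j' k :
  monalg.mcoeff (j, i) (gam j' k) = ((j' == j) && (k == i.+1))%:R :> 'F_2.
Proof.
by case: k => [|i'] /=; rewrite ?monalg.mcoeff0 ?andbF // monalg.mcoeffU xpair_eqE eqSS.
Qed.

Lemma fil_gam p j k : (p <= - j%:Z)%R -> filNC_mem p (gam j k).
Proof.
by move=> pj j' i; rewrite mcoeff_gam; have [<-|_] := eqVneq j j'; rewrite //= eqxx.
Qed.

Lemma filD p (x y : NC) : filNC_mem p x -> filNC_mem p y -> filNC_mem p (x + y).
Proof. by rewrite -[y in x + y]opprK => Fx Fy; apply: (@fil_memB p 0) => //;
  rewrite oppx. Qed.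

(** A step of the filtration is spanned by the symbols gamma / (rho^j tau^k)
    that it contains. *)
Lemma fil_ind (V : lmodType 'F_2) (f : {linear NCspace -> V}) (Q : V -> Prop) p (x : NC) :
  Q 0 -> (forall u v, Q u -> Q v -> Q (u + v)) ->
  (forall j k, (p <= - j%:Z)%R -> Q (f (gam j k))) -> filNC_mem p x -> Q (f x).
Proof.
move=> Q0 QD Qg Fx; rewrite (monalgE (x : NCspace)) linear_sum.
elim/big_rec: _ => // -[j i] y _ Qy; apply: QD => //.
case: (F2P (monalg.mcoeff (j, i) (x : NCspace))) => [->|c1].
  have -> : mkmalgU (j, i) 0 = 0 :> NCspace; last by rewrite raddf0.
  by apply/malgP => s; rewrite monalg.mcoeff0 monalg.mcoeffU mul0rn.
rewrite c1 -[mkmalgU _ _]/(gam j i.+1); apply: Qg; apply: (Fx j i).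
by rewrite c1.
Qed.

Lemma fil_rho p (x : NC) : filNC_mem p x -> filNC_mem (p + 1) (rt_rho NC x).
Proof.
apply: (@fil_ind _ (rt_rho NC) (filNC_mem (p + 1))).
- exact: (@fil_mem0 _ 0).
- exact: filD.
move=> j k pj; rewrite [rt_rho NC _]rho_gam; case: j pj => [|j] pj.
  exact: (@fil_mem0 _ 0).
by apply: fil_gam; rewrite -lerBrDr -opprD -PoszD addn1.
Qed.

Lemma fil_leq p q (x : NC) : (q <= p)%R -> filNC_mem p x -> filNC_mem q x.
Proof. by move=> qp Fx j i /Fx; exact: le_trans. Qed.

Lemma stable_fil p : stable (filNC_mem p).
Proof.
split; [exact: (@fil_mem0 _ 0) | exact: filD | move=> x Fx | ].
  by apply: (fil_leq _ (fil_rho Fx)); rewrite lerDl.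
move=> x; apply: (@fil_ind _ (rt_tau NC) (filNC_mem p)).
- exact: (@fil_mem0 _ 0).
- exact: filD.
by move=> j k pj; rewrite [rt_tau NC _]tau_gam; exact: fil_gam.
Qed.

Lemma fil_liftn p n (x : cob NC n) : fil_mem p x <-> liftn (filNC_mem p) x.
Proof. by elim: n x => [|n IHn] x //; split=> Fx m; apply/IHn/Fx. Qed.

(** The truncated series of the coaction, with (1 + X) geom = 1 + X^(j+1). *)
Definition geom (j : nat) : {poly 'F_2} := \sum_(l < j.+1) 'X^l.

(** Multiply (1 + X) geom = 1 + X^(j+1) by geom^k and compare the
    coefficients up to degree j. *)
Lemma coef_geomS j k i : (i <= j)%N ->
  (geom j ^+ k)`_i = (geom j ^+ k.+1)`_i + (if i is i'.+1 then (geom j ^+ k.+1)`_i' else 0).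
Proof.
move=> le_ij; have := subrX1 ('X : {poly 'F_2}) j.+1.
rewrite -/(geom j) => /(congr1 (fun p => (geom j ^+ k * p)`_i)).
have -> : geom j ^+ k * (('X - 1) * geom j) = 'X * geom j ^+ k.+1 - geom j ^+ k.+1.
  by rewrite mulrCA -exprSr mulrBl mul1r.
rewrite mulrBr mulr1 !coefB coefMXn ltnS le_ij sub0r coefXM.
move/(congr1 -%R); rewrite opprK opprB => ->; congr (_ + _).
by rewrite oppF2; case: (i).
Qed.

Lemma pchar_poly2 : 2%N \in [pchar {poly 'F_2}].
Proof. by rewrite pchar_poly; apply: pchar_Fp. Qed.

(** By Frobenius geom^(2^e) is a polynomial in X^(2^e), and 2^e exceeds j. *)
Lemma coef_geom_pow2 j e i : (i <= j)%N -> (j < 2 ^ e)%N ->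
  (geom j ^+ (2 ^ e))`_i = (i == 0%N)%:R.
Proof.
move=> le_ij lt_j; rewrite /geom.
have -> : (\sum_(l < j.+1) 'X^l : {poly 'F_2}) ^+ (2 ^ e) = \sum_(l < j.+1) 'X^(l * 2 ^ e).
  elim: e {lt_j} => [|e IHe]; first by rewrite expr1; apply: eq_bigr => l _; rewrite muln1.
  rewrite expnSr exprM IHe -(pFrobenius_autE pchar_poly2) rmorph_sum.
  by apply: eq_bigr => l _; rewrite /= pFrobenius_autE -exprM mulnA.
rewrite coef_sum big_ord_recl /= mul0n expr0 coef1 big1 ?addr0 // => l _.
rewrite coefXn /bump leq0n add1n mulSn; case: eqP => // Ei; exfalso.
by move: (leq_ltn_trans le_ij lt_j); rewrite Ei ltnNge leq_addr.
Qed.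

Lemma psi_gam0 j : psi_gam j 0 = 0.
Proof.
rewrite /psi_gam big1 // => -[i lt_i] _ /=; rewrite expr0 coef1.
case: i lt_i => [|i] _ /=; last by rewrite scale0r.
by rewrite /= scale1r; exact: (raddf0 (@unit_r NC)).
Qed.
Lemma psi_NC_gam j k : psi_NC (gam j k) = psi_gam j k.
Proof.
case: k => [|k]; first by rewrite psi_gam0; exact: raddf0.
exact: linextU.
Qed.

(** For large powers of two the symbol is primitive. As gamma / (rho^j
    tau^k) is a tau-multiple of such a symbol and the coaction is
    tau-linear, this determines the whole coaction and all its properties. *)
Lemma psi_gam_pow2 j e : (j < 2 ^ e)%N -> psi_gam j (2 ^ e) = unit_r (gam j (2 ^ e) : NC).
Proof.
move=> lt_j; rewrite /psi_gam -/(geom j) big_ord_recl [X in _ + X]big1 ?addr0 /=;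
  last first.
  by move=> i _; rewrite coef_geom_pow2 /= ?scale0r //.
by rewrite coef_geom_pow2 // scale1r subn0 addn0.
Qed.

Lemma sum_shift (V : lmodType 'F_2) (c c' : nat -> 'F_2) (A : nat -> V) n :
  c' 0%N = c 0%N -> (forall i, (i < n)%N -> c' i.+1 = c i.+1 + c i) ->
  \sum_(i < n.+1) c i *: A i + \sum_(i < n.+1) c i *: (if (i < n)%N then A i.+1 else 0)
    = \sum_(i < n.+1) c' i *: A i.
Proof.
move=> c0 cS; rewrite [X in _ + X]big_ord_recr /= ltnn scaler0 addr0.
rewrite big_ord_recl [RHS]big_ord_recl /= -addrA -big_split c0; congr (_ + _).
by apply: eq_bigr => i _; rewrite /= ltn_ord /bump leq0n add1n cS // scalerDl.
Qed.

(** Multiplying by eta_R(tau) = tau (1 + rho tau_0 / tau) removes one factor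
    of the power of the geometric series. *)
Lemma psi_gam_tau j k : tau_r (psi_gam j k.+1) = psi_gam j k.
Proof.
pose mt := @mul_tau0 NC.
pose A i : tensA NC := iter i mt (unit_r (gam (j - i) (k + i) : NC)).
pose c i := (geom j ^+ k.+1)`_i.
have tauA i : (i <= j)%N ->
    tau_r (iter i mt (unit_r (gam (j - i) (k.+1 + i) : NC))) = A i +
      (if (i < j)%N then A i.+1 else 0).
  move=> le_ij; rewrite /A.
  have -> : forall x : tensA NC, tau_r (iter i mt x) = iter i mt (tau_r x).
    by move=> x; elim: (i) => //= i' <-; rewrite tau_mul_tau0.
  rewrite tau_r_unit raddfD; congr (_ + _); first by rewrite [rt_tau _ _]tau_gam.
  rewrite [rt_rho _ _]rho_gam; case: ltngtP le_ij => // [lt_ij|->] _.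
    rewrite -[LHS](iterSr i mt) subnS.
    have : (0 < j - i)%N by rewrite subn_gt0.
    rewrite addSnnS => ij0; apply: (congr1 (fun z : NC => iter i.+1 mt (unit_r z))).
    by case: (j - i)%N ij0.
  by rewrite subnn !raddf0.
rewrite /psi_gam raddf_sum.
transitivity (\sum_(i < j.+1) c i *: A i + \sum_(i < j.+1) c i *:
  (if (i < j)%N then A i.+1 else 0)).
  rewrite -big_split /=; apply: eq_bigr => i _;
    rewrite -scalerDr [LHS](linearZ_LR (@tau_r NC)).
  by congr (_ *: _); apply: tauA; rewrite -ltnS.
apply: (@sum_shift (tensA NC) c (fun i => (geom j ^+ k)`_i) A j) => [|i lt_ij].
  by rewrite (coef_geomS k (leq0n j)) addr0.
exact: (coef_geomS k lt_ij).
Qed.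

Lemma psi_NC_tau (x : NC) : psi_NC (rt_tau NC x) = tau_r (psi_NC x).
Proof.
apply: (@eq_linear_gam _ (psi_NC \o tau_NC) (@tau_r NC \o psi_NC)) x => j i.
change (psi_NC (tau_NC (gam j i.+1)) = tau_r (psi_NC (gam j i.+1))).
by rewrite tau_gam !psi_NC_gam psi_gam_tau.
Qed.

Lemma gam_tau_iter j k M : (k <= M)%N -> gam j k = iter (M - k) (rt_tau NC) (gam j M).
Proof.
move=> le_kM; rewrite -[in LHS](subKn le_kM); elim: (M - k)%N => [|a IHa]; first by
  rewrite subn0.
by rewrite iterS -IHa [rt_tau _ _]tau_gam subnS.
Qed.

Lemma psi_NC_pow2 j k e : (j < 2 ^ e)%N -> (k <= 2 ^ e)%N ->
  psi_NC (gam j k) = iter (2 ^ e - k) (@tau_r NC) (unit_r (gam j (2 ^ e) : NC)).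
Proof.
move=> lt_j le_k; rewrite (gam_tau_iter j le_k) (iter_intertwine _ _ psi_NC_tau).
by rewrite psi_NC_gam psi_gam_pow2.
Qed.

Lemma big_pow2 j k : exists e, (j < 2 ^ e)%N && (k <= 2 ^ e)%N.
Proof.
exists (maxn j k); have := ltn_expl (maxn j k) (ltnSn 1).
move=> lt_e; apply/andP; split.
  exact: leq_ltn_trans (leq_maxl j k) lt_e.
exact: ltnW (leq_ltn_trans (leq_maxr j k) lt_e).
Qed.

Lemma psi_NC_rho (x : NC) : psi_NC (rt_rho NC x) = rho_r (psi_NC x).
Proof.
apply: (@eq_linear_gam _ (psi_NC \o rho_NC) (@rho_r NC \o psi_NC)) x => j i.
change (psi_NC (rho_NC (gam j i.+1)) = rho_r (psi_NC (gam j i.+1))).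
have [e /andP[lt_j le_i]] := big_pow2 j i.+1.
rewrite (psi_NC_pow2 lt_j le_i).
rewrite (iter_intertwine _ _ (@rho_tau_r NC)).
have -> : rho_r (unit_r (gam j (2 ^ e) : NC)) = unit_r (rt_rho NC (gam j (2 ^ e))).
  exact: (cwise_unit (M := NC) (M' := NC) _ (raddf0 (rt_rho NC))).
rewrite [rt_rho _ _]rho_gam rho_gam; case: j lt_j => [|j] lt_j.
  rewrite !raddf0; elim: (_ - _)%N => //= a <-; by rewrite raddf0.
by rewrite (psi_NC_pow2 (ltnW lt_j) le_i).
Qed.

Lemma morph_psi_NC : morph (fun z => z = 0) psi_NC.
Proof.
split=> [x y|x|x]; first exact: raddfD.
  by apply/(@eq_mod_eq0 (tensA NC)); exact: psi_NC_rho.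
by apply/(@eq_mod_eq0 (tensA NC)); exact: psi_NC_tau.
Qed.

(** Compatibility with rho and coassociativity are clear for primitive
    elements and pass to tau-multiples. *)
Lemma comodule_NC : comodule psi_NC.
Proof.
split; [exact: psi_NC_rho | exact: psi_NC_tau |].
apply: (@eq_linear_gam _ (@coprod NC \o psi_NC) (cwise psi_NC \o psi_NC)) => j i.
change (coprod (psi_NC (gam j i.+1)) = cwise psi_NC (psi_NC (gam j i.+1))).
have [e /andP[lt_j le_i]] := big_pow2 j i.+1.
rewrite (psi_NC_pow2 lt_j le_i); set g := unit_r _.
rewrite (@iter_intertwine _ _ (@coprod NC) _ _ _ _ (@coprod_tau NC)) coprod_unit.
have E : forall x : tensA NC, cwise psi_NC (tau_r x) = rt_tau (tensA (tensA NC))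
  (cwise psi_NC x).
  move=> x; apply/(@eq_mod_eq0 (tensA (tensA NC)))/(@liftn_eq0 (tensA NC) 1).
  exact: (morph_tau (morph_cwise (stable_eq0 _) morph_psi_NC)).
rewrite (@iter_intertwine _ _ (cwise psi_NC) _ _ _ _ E)
  (cwise_unit (M := NC) (M' := tensA NC)) ?raddf0 //.
by rewrite psi_NC_gam psi_gam_pow2.
Qed.

(** * The filtration by powers of rho *)

Lemma psi_NC_fil p (x : NC) : filNC_mem p x -> @liftn NC (filNC_mem p) 1 (psi_NC x).
Proof.
have S1 := stable_liftn 1 (stable_fil p).
apply: (@fil_ind _ psi_NC (@liftn NC (filNC_mem p) 1)); [exact: stable0 | exact: stableD |].
move=> j k pj; have [e /andP[lt_j le_k]] := big_pow2 j k.
rewrite (psi_NC_pow2 lt_j le_k); elim: (_ - _)%N => [|a IHa] /=.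
  exact: (stable_unit (stable_fil p) (fil_gam pj)).
exact: (stable_tau S1).
Qed.

Lemma dNC_fil p n (x : cob NC n) : fil_mem p x -> fil_mem p (dNC n x).
Proof.
by move/fil_liftn => Fx; apply/fil_liftn; exact: (stable_d (stable_fil p) (@psi_NC_fil p)).
Qed.

Lemma dNC_dNC n (x : cob NC n) : dNC n.+1 (dNC n x) = 0.
Proof. exact: (cob_d_d comodule_NC). Qed.

Lemma fil_lift_rho p (x : tensA NC) :
  @liftn NC (filNC_mem p) 1 x -> @liftn NC (filNC_mem (p + 1)) 1 (rho_r x).
Proof. by move=> Fx m; rewrite ffunE; exact/fil_rho/Fx. Qed.
Lemma fil_lift_tau0 p (x : tensA NC) :
  @liftn NC (filNC_mem p) 1 x -> @liftn NC (filNC_mem p) 1 (mul_tau0 x).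
Proof.
by move=> Fx; rewrite mul_tau0_generic;
  apply: (@stable_eval_chain NC _ (stable_fil p) _ 1) => v; exact: Fx.
Qed.

Lemma eq_mod_cwise_tau (N : rtmod) (P : N -> Prop) (x y : tensA N) : stable P ->
  eq_mod (@liftn N P 1) x y ->
  eq_mod (@liftn N P 1) (cwise (rt_tau N) x : tensA N) (cwise (rt_tau N) y).
Proof.
move=> PP xy m; have := xy m; rewrite !ffunE => xym.
by rewrite -raddfB; exact: (stable_tau PP).
Qed.

(** Modulo rho the right unit of tau is tau. *)
Lemma psi_NC_unit p (x : NC) : filNC_mem p x ->
  eq_mod (@liftn NC (filNC_mem (p + 1)) 1) (psi_NC x) (unit_r x).
Proof.
have Sp := stable_fil (p + 1); have S1 := stable_liftn 1 Sp.
apply: (@fil_ind _ idfun (fun y : NC => eq_mod _ (psi_NC y) (unit_r y))).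
- by rewrite !raddf0; exact: (eq_mod_refl S1).
- by move=> u v Qu Qv; rewrite [psi_NC _]raddfD [unit_r _]raddfD; exact: (eq_modD S1 Qu Qv).
move=> j k pj; have [e /andP[lt_j le_k]] := big_pow2 j k.
change (eq_mod (@liftn NC (filNC_mem (p + 1)) 1) (psi_NC (gam j k))
  (unit_r (gam j k : NC))).
rewrite (psi_NC_pow2 lt_j le_k) (gam_tau_iter j le_k).
set g := gam j _; have Fg : filNC_mem p g by exact: fil_gam.
have Fi a : @liftn NC (filNC_mem p) 1 (iter a (@tau_r NC) (unit_r (g : NC))).
  elim: a => [|a IHa] /=; first exact: (stable_unit (stable_fil p)).
  exact: (stable_tau (stable_liftn 1 (stable_fil p))).
elim: (_ - _)%N => [|a IHa]; first exact: (eq_mod_refl S1).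
rewrite !iterS -(cwise_unit _ (raddf0 (rt_tau NC))) [X in eq_mod _ X _]/tau_r.
rewrite -[X in eq_mod _ _ X]addr0; apply: (eq_modD S1).
  exact: eq_mod_cwise_tau.
apply/(eq_mod0 _ _); exact/(@fil_lift_rho p)/fil_lift_tau0/Fi.
Qed.

(** The exponent 2k differs from a large power of two by an even number, and
    the square of eta_R(tau) is tau^2 modulo rho^2. *)
Lemma psi_NC_even j k :
  eq_mod (@liftn NC (filNC_mem (- j%:Z + 2)) 1) (psi_NC (gam j k.*2))
    (unit_r (gam j k.*2 : NC)).
Proof.
set p : int := - j%:Z + 2; have Sp := stable_fil p; have S1 := stable_liftn 1 Sp.
have [e /andP[lt_j le_k]] := big_pow2 j k.*2.
have lt_j' : (j < 2 ^ e.+1)%N by apply: leq_trans lt_j _; rewrite leq_exp2l.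
have le_k' : (k.*2 <= 2 ^ e.+1)%N by apply: leq_trans le_k _; rewrite leq_exp2l.
rewrite (psi_NC_pow2 lt_j' le_k') (gam_tau_iter j le_k').
(* A power of two larger than needed, so that the difference to 2k is twice
   an integer. *)
rewrite expnS mul2n -doubleB; set g := gam j _.
have Fg : filNC_mem (- j%:Z) g by exact: fil_gam.
elim: (_ - _)%N => [|a IHa]; first exact: (eq_mod_refl S1).
rewrite doubleS [X in eq_mod _ X _]/= tau_r_sqr.
have -> : unit_r (iter a.*2.+2 (rt_tau NC) g) =
  cwise (rt_tau NC) (cwise (rt_tau NC) (unit_r (iter a.*2 (rt_tau NC) g : NC))).
  by rewrite !(cwise_unit _ (raddf0 (rt_tau NC))).
rewrite -[X in eq_mod _ _ X]addr0; apply: (eq_modD S1).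
  exact: (eq_mod_cwise_tau Sp (eq_mod_cwise_tau Sp IHa)).
have -> : p = - j%:Z + 1 + 1 by rewrite /p -addrA.
apply/(eq_mod0 _ _)/fil_lift_rho/fil_lift_rho/fil_lift_tau0/fil_lift_tau0.
elim: (a.*2) => [|b IHb] /=; first exact: (stable_unit (stable_fil _)).
exact: (stable_tau (stable_liftn 1 (stable_fil _))).
Qed.

(** * Multiplication by gamma / (rho^j tau^k) *)

Lemma comodule_Ftau : comodule psi_tau.
Proof.
have u0 (f : Ftau -> Ftau) (y : Ftau) : f 0 = 0 ->
  cwise f (@unit_r Ftau y) = unit_r (f y) := @cwise_unit _ _ f y.
split=> x.
- exact/esym/(u0 _ _ (raddf0 (rt_rho Ftau))).
- by rewrite [RHS]tau_r_unit (_ : rt_rho Ftau x = 0) // raddf0 raddf0 addr0.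
rewrite [LHS]coprod_unit [RHS](cwise_unit (M := Ftau) (M' := tensA Ftau)) //.
exact: (raddf0 psi_tau).
Qed.

Lemma dC_dC n (x : cob Ftau n) : dC n.+1 (dC n x) = 0.
Proof. exact: (cob_d_d comodule_Ftau). Qed.

(** The map F_2[tau] -> NC, p |-> p gamma / (rho^j tau^k), which induces
    gam_tens on cobar complexes. *)
Definition mul_gam (j k : nat) (p : Ftau) : NC := tau_eval p (gam j k : NC).
Lemma gam_tensE j k n (x : cob Ftau n) : gam_tens j k x = cobmap (mul_gam j k) x.
Proof. by elim: n x => [|n IHn] x //; apply/ffunP=> m; rewrite [LHS]ffunE [RHS]ffunE;
  exact: IHn. Qed.

Lemma iter_tau_gam j k i : iter i (rt_tau NC) (gam j k) = gam j (k - i).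
Proof. by elim: i => [|i IHi]; rewrite ?subn0 // iterS IHi [rt_tau _ _]tau_gam subnS. Qed.

Lemma mul_gamE j k n (p : Ftau) : (size (p : {poly 'F_2}) <= n)%N ->
  mul_gam j k p = \sum_(i < n) (p : {poly 'F_2})`_i *: (gam j (k - i) : NC).
Proof.
move=> le_n; rewrite /mul_gam /tau_eval
  (big_ord_widen n (fun i => (p : {poly 'F_2})`_i *: iter i (rt_tau NC) (gam j k)) le_n).
rewrite big_mkcond; apply: eq_bigr => i _; rewrite iter_tau_gam.
by case: ltnP => // le_i; rewrite nth_default ?scale0r.
Qed.

Lemma mul_gamD j k (p q : Ftau) : mul_gam j k (p + q) = mul_gam j k p + mul_gam j k q.
Proof.
pose n := maxn (size (p : {poly 'F_2})) (size (q : {poly 'F_2})).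
rewrite (@mul_gamE _ _ n) ?(@mul_gamE _ _ n p) ?(@mul_gamE _ _ n q) ?leq_maxl ?leq_maxr
  ?size_polyD //.
by rewrite -big_split; apply: eq_bigr => i _ /=; rewrite coefD scalerDl.
Qed.

Lemma mul_gam_tau j k (p : Ftau) : mul_gam j k (rt_tau Ftau p) = rt_tau NC (mul_gam j k p).
Proof.
pose n := size (p : {poly 'F_2}).
rewrite (@mul_gamE _ _ n.+1 (rt_tau Ftau p)) ?(@mul_gamE _ _ n p) //; last first.
  by rewrite /= /tau_poly mulrC; apply: leq_trans (size_polyMleq _ _) _;
    rewrite size_polyX addn2.
rewrite big_ord_recl /= /tau_poly coefXM scale0r add0r raddf_sum; apply: eq_bigr => i _.
by rewrite coefXM /= [RHS](linearZ_LR (rt_tau NC)) [rt_tau _ _]tau_gam subnS.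
Qed.

Lemma mul_gam_fil j k (p : Ftau) : filNC_mem (- j%:Z) (mul_gam j k p).
Proof.
rewrite (@mul_gamE _ _ _ p (leqnn _)); elim/big_ind: _ => [||i _].
- exact: (stable0 (stable_fil _)).
- exact: (stableD (stable_fil _)).
case: (F2P (p : {poly 'F_2})`_i) => ->; rewrite ?scale0r ?scale1r.
  exact: (stable0 (stable_fil _)).
exact: fil_gam.
Qed.

Lemma morph_mul_gam j k : morph (filNC_mem (- j%:Z + 1)) (mul_gam j k).
Proof.
have S := stable_fil (- j%:Z + 1).
split=> [p q|p|p]; first exact: mul_gamD.
  rewrite [mul_gam j k _](_ : _ = 0) /eq_mod; last first.
    by rewrite /mul_gam /tau_eval /= /rho_poly size_poly0 big_ord0.
  by rewrite sub0r oppx; exact/fil_rho/mul_gam_fil.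
by rewrite mul_gam_tau; exact: (eq_mod_refl S).
Qed.

Lemma psi_mul_gam j k (p : Ftau) :
  eq_mod (@liftn NC (filNC_mem (- j%:Z + 1)) 1) (psi_NC (mul_gam j k p))
    (cwise (mul_gam j k) (psi_tau p)).
Proof.
rewrite [psi_tau p]/= (cwise_unit (M := Ftau) (M' := NC)).
  exact/psi_NC_unit/mul_gam_fil.
by rewrite /mul_gam /tau_eval size_poly0 big_ord0.
Qed.

(** The associated graded complex of the filtration is a sum of copies of
    F_2[tau]/tau^oo (x) C, for C the cobar complex of A / rho. *)
Lemma gam_tens_d j k n (x : cob Ftau n) :
  fil_mem (- j%:Z + 1) (dNC n (gam_tens j k x) - gam_tens j k (dC n x)).
Proof.
apply/fil_liftn; rewrite !gam_tensE.
exact: (cobmap_d (stable_fil _) (morph_mul_gam j k) (@psi_mul_gam j k)).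
Qed.

Lemma gam_tens_fil j k n (x : cob Ftau n) : fil_mem (- j%:Z) (gam_tens j k x).
Proof.
by elim: n x => [|n IHn] x; [exact: mul_gam_fil | move=> m; rewrite ffunE; exact: IHn].
Qed.
Lemma gam_tensD j k n (x y : cob Ftau n) : gam_tens j k (x + y) = gam_tens j k x +
  gam_tens j k y.
Proof. by rewrite !gam_tensE; exact:
  (morphD (morph_cobmap n (stable_fil _) (morph_mul_gam j k))). Qed.

(** * The first page and Ext_C *)

Section Subquotient.
Variables (V : zmodType) (Z B : subgroup V).
Lemma cls_val x : Z x -> cycle_val (insubd (0 : zcycle Z) x) = x.
Proof. by move=> Zx; rewrite -[LHS]/(val _) insubdK //; apply/asboolP. Qed.
Lemma clsP x y : Z x -> Z y -> cls Z B x = cls Z B y <-> B (x - y).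
Proof.
move=> Zx Zy; rewrite /cls.
have -> : B (x - y) <-> (insubd (0 : zcycle Z) x - insubd (0 : zcycle Z) y) \in
  (bound_pred B : {pred zcycle Z}).
  by split=> [Bxy|/asboolP]; [apply/asboolP|]; rewrite raddfB /= !cls_val.
rewrite (ring_quotient.Quotient.idealrBE (bound_pred B : zmodClosed (zcycle Z))).
by split=> [->|/eqP].
Qed.
Lemma repZ (u : subquot Z B) : Z (rep u).
Proof. by rewrite /rep; case: (repr u) => x /= /asboolP. Qed.
Lemma repK (u : subquot Z B) : cls Z B (rep u) = u.
Proof.
rewrite /cls /rep -[RHS]reprK; congr (\pi_(subquot Z B) _)%qT.
by apply/val_inj; rewrite /= cls_val //; exact: repZ.
Qed.
Lemma rep_cls x : Z x -> B (rep (cls Z B x) - x).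
Proof. by move=> Zx; apply/clsP => //; [exact: repZ | exact: repK]. Qed.
Lemma cls0 : cls Z B 0 = 0.
Proof.
rewrite /cls -[RHS](@pi_zeror _ _ _ _ _ (subquot Z B)).
by congr (\pi_(subquot Z B) _)%qT; apply/val_inj; rewrite /= cls_val //; exact: sg_mem0.
Qed.
Lemma cls_eq0 x : Z x -> B x -> cls Z B x = 0.
Proof. by move=> Zx Bx; rewrite -cls0; apply/clsP => //;
  [exact: sg_mem0 | rewrite subr0]. Qed.
End Subquotient.

Lemma Br_fil s n (x : cob NC n) : fil_mem (- s%:Z + 1) x -> Br dNC fil 1 (- s%:Z) n x.
Proof.
move=> Fx; exists x, 0; split; last by rewrite addr0.
  by split=> //=; rewrite addr0; exact: dNC_fil.
exact: (@im_mem0 _ dNC (fun m => Zr dNC fil 0 (- s%:Z - 0%:Z) m) n).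
Qed.

Lemma Br_d s n (x : cob NC n) : fil_mem (- s%:Z) x -> Br dNC fil 1 (- s%:Z) n.+1 (dNC n x).
Proof.
move=> Fx; exists 0, (dNC n x); split; last by rewrite add0r.
  exact: sg_mem0.
by exists x => //; split=> /=; rewrite ?subr0 ?addr0 //; exact: dNC_fil.
Qed.

Lemma BrD s n (x y : cob NC n) : Br dNC fil 1 (- s%:Z) n x -> Br dNC fil 1 (- s%:Z) n y ->
  Br dNC fil 1 (- s%:Z) n (x + y).
Proof. by move=> Bx By; rewrite -[y in _ + y]oppx; exact: sg_memB. Qed.

Lemma BrS s n (x : cob NC n.+1) : Br dNC fil 1 (- s%:Z) n.+1 x ->
  exists u v, [/\ fil_mem (- s%:Z + 1) u, fil_mem (- s%:Z) v & x = u + dNC n v].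
Proof.
case=> u [_ [[Fu _] [v [Fv _] ->] ->]]; exists u, v; split=> //.
by move: Fv; rewrite subr0.
Qed.

Lemma opp_succ (s : nat) : - (1 + s)%N%:Z + 1 = - s%:Z :> int.
Proof. by rewrite PoszD opprD addrAC addNr add0r. Qed.

(** The differential may be computed on any representative: a change of the
    representative by an element of higher filtration changes the result by
    a boundary, and a change by a boundary does not change it because d d =
    0. *)
Lemma d_clsE s n (z : cob NC n) (w : cob NC n.+1) :
  Zr dNC fil 1 (- (1 + s)%N%:Z) n z -> fil_mem (- s%:Z + 1) (dNC n z - w) ->
  d_ (clsE (1 + s) z : Eminus 1 (1 + s) n) = clsE s w.
Proof.
move=> Zz Fw; rewrite /d_ /dr /clsE.
set r := rep _; have Brz : Br dNC fil 1 (- (1 + s)%N%:Z) n (r - z) by exact: rep_cls.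
have [_ Fr] : Zr dNC fil 1 (- (1 + s)%N%:Z) n r by exact: repZ.
move: (Zz) => [_ Fz].
rewrite opp_succ in Fr Fz.
have Fw' : fil_mem (- s%:Z) w.
  rewrite -[w](subKr (dNC n z)); apply: (@fil_memB _ n.+1) => //.
  by apply/fil_liftn; move/fil_liftn: Fw; 
    elim: n.+1 (dNC n z - w) => [|m IHm] y Fy;
      [apply: (fil_leq _ Fy); rewrite lerDl | move=> k; apply: IHm].
have dw : fil_mem (- s%:Z + 1) (dNC n.+1 w).
  have -> : dNC n.+1 w = dNC n.+1 (w - dNC n z).
    by rewrite raddfB [X in _ - X](dNC_dNC z) subr0.
  by apply: dNC_fil; rewrite -opprB oppx.
apply/clsP.
- split=> //; exact: (eq_ind_r (fil _ _) (sg_mem0 _) (dNC_dNC r)).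
- by split.
have -> : dNC n r - w = dNC n (r - z) + (dNC n z - w) by rewrite raddfB addrA subrK.
apply: BrD; last exact: Br_fil.
case: n z w r Zz Fw Brz {Fr Fz Fw' dw} => [|n] z w r Zz Fw.
  by case=> u [v [[Fu _] -> ->]]; rewrite addr0; apply: Br_d; move: Fu; rewrite opp_succ.
case/BrS => u [v [Fu Fv ->]]; rewrite raddfD [X in _ + X](dNC_dNC v) addr0; apply: Br_d.
by move: Fu; rewrite opp_succ.
Qed.

Lemma clsE_eq s n (x y : cob NC n) :
  Zr dNC fil 1 (- s%:Z) n x -> Zr dNC fil 1 (- s%:Z) n y ->
    Br dNC fil 1 (- s%:Z) n (x - y) ->
  clsE s x = clsE s y.
Proof. by move=> Zx Zy Bxy; apply/clsP. Qed.

Lemma Zr_gam_tens s k n (c : cob Ftau n) : gam_tens s k (dC n c) = 0 ->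
  Zr dNC fil 1 (- s%:Z) n (gam_tens s k c).
Proof.
move=> dc0; split; first exact: gam_tens_fil.
by have := gam_tens_d s k c; rewrite dc0 subr0.
Qed.

Lemma clsC_eq n (x y : cob Ftau n) : dC n x = 0 -> dC n y = 0 ->
  clsC x = clsC y <-> coboundary dC n (x - y).
Proof. exact: (@clsP _ (cocycle dC n) (coboundary dC n)). Qed.

Lemma repC_cocycle n (u : ExtC n) : dC n (rep u) = 0.
Proof. exact: (repZ u). Qed.

Lemma gamE_clsC j k n (z : cob Ftau n) : dC n z = 0 ->
  gamE j k (clsC z) = clsE j (gam_tens j k z).
Proof.
move=> dz; have := @rep_cls _ (cocycle dC n) (coboundary dC n) z dz.
rewrite /gamE -/(clsC z); set r := rep (clsC z) => Brz.
have dr0 : dC n r = 0 by exact: repC_cocycle.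
have Z0 x : dC n x = 0 -> Zr dNC fil 1 (- j%:Z) n (gam_tens j k x).
  move=> dx; apply: Zr_gam_tens; rewrite dx gam_tensE;
    exact: (morph0 (morph_cobmap _ (stable_fil _) (morph_mul_gam j k))).
apply: clsE_eq; [exact: Z0 | exact: Z0 |].
have -> : gam_tens j k r - gam_tens j k z = gam_tens j k (r - z).
  by rewrite -[r in LHS](subrK z) gam_tensD addrK.
case: n z dz r Brz {dr0 Z0} => [|n] z dz r Brz.
  rewrite [r - z]Brz gam_tensE (morph0 (morph_cobmap _ (stable_fil _) (morph_mul_gam j k))).
  exact: sg_mem0.
case: Brz => y _ ->.
rewrite -[gam_tens _ _ _](subrKC (dNC n (gam_tens j k y))); apply: BrD; last first.
  by apply: Br_fil; rewrite -opprB oppx; exact: gam_tens_d.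
exact/Br_d/gam_tens_fil.
Qed.

Lemma repC0 (p : cob Ftau 0) : dC 0 p = 0 -> rep (clsC p) = p :> cob Ftau 0.
Proof.
move=> dp; apply/eqP; rewrite -subr_eq0; apply/eqP.
exact: (@rep_cls _ (cocycle dC 0) (coboundary dC 0) p dp).
Qed.

Lemma dC0 (p : cob Ftau 0) : dC 0 p = 0.
Proof. exact: (addxx (unit_r p : tensA Ftau)). Qed.

(** The class of 1 has only the representative 1, as there are no boundaries
    in degree zero. *)
Lemma gext_mulg1 (u : gradedC) : gext_mul u gext_one = u.
Proof.
case: u => n u; rewrite /gext_mul /= /ext_mul /oneC repC0 ?dC0 //.
rewrite /inC /=; congr (Tagged ExtC _).
have -> : tau_eval (1 : {poly 'F_2}) (rep u : cob Ftau n) = rep u.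
  by rewrite /tau_eval size_poly1 big_ord1 coef1 scale1r.
exact: (repK u).
Qed.

Section Presentation.
Variables (h0 h1 : ExtC 1) (a : ExtC 3) (b : ExtC 4).
Hypothesis hExt : ExtC_presentation h0 h1 a b.

Lemma gext_mul1g u : gext_mul gext_one u = u.
Proof. by case: hExt => _ -> _ _; exact: gext_mulg1. Qed.

End Presentation.

(** * Linear algebra over F_2 by elimination *)

Definition tau_part (i : nat) (L : form) : seq nat :=
  [seq t.2 | t <- L & (t.1.1 == i) && (t.1.2 == 0%N)].

(** Each entry p :: r of B is a relation solved for p; the entries are used
    in order, so that no pivot comes back. *)
Definition reduce (B : seq (seq nat)) (L : seq nat) : seq nat :=
  foldl (fun L r => if r is p :: _ then if p \in L then xor_seq r L else L else L)
    (xor_seq L [::]) B.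

(** Gaussian elimination: a linear form that reduces to the empty list
    vanishes whenever the relations hold, by eval_lin_eq0. *)
Definition eliminate (R : seq (seq nat)) : seq (seq nat) :=
  foldl (fun B r => let r' := reduce B r in if nilp r' then B else rcons B r') [::] R.

Fixpoint map_leaves (f : form -> form) n : formal_cob n -> formal_cob n :=
  match n return formal_cob n -> formal_cob n with 0 => f | n'.+1 =>
    tmap (@map_leaves f n') end.

(** Substitutes the sum of the symbols in l for the only symbol of L. *)
Definition subst_form (l : seq nat) (L : form) : form :=
  flatten [seq [seq (t.1, v) | v <- l] | t <- L].

(** * The explicit cochains and their verification *)

Definition mX : mon := (false, false, true).
Definition mT1 : mon := (false, true, false).
Definition mT1X : mon := (false, true, true).
Definition mT0 : mon := (true, false, false).
Definition mT0X : mon := (true, false, true).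
Definition mT0T1 : mon := (true, true, false).
Definition mT0T1X : mon := (true, true, true).

Definition chain1 (f : mon -> form) : formal_cob 1 := tab f.
Definition chain2 (f : mon -> mon -> form) : formal_cob 2 :=
  tab (fun m2 => tab (fun m1 => f m1 m2)).
Definition chain3 (f : mon -> mon -> mon -> form) : formal_cob 3 :=
  tab (fun m3 => tab (fun m2 => tab (fun m1 => f m1 m2 m3))).

(** The cochain tau c0 with c0 = [xi_1|tau_0 tau_1] + [tau_1|tau_1] + [xi_1
    tau_1|tau_0], where d(c0) = tau [xi_1|xi_1|xi_1] modulo rho. Hence gamma
    / (rho^s tau) c0 represents (Q / rho^s) h1^3. The common factor tau is
    there because the symbol stands for gamma / (rho^s tau^2), which is
    primitive modulo rho^2. *)
Definition c0_form : formal_cob 2 := chain2 (fun m1 m2 =>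
  if (m1, m2) \in [:: (mX, mT0T1); (mT1, mT1); (mT1X, mT0)] then [:: (1, 0, 0)%N] else
    [::]).

(** The coefficient of rho in the differential of tau c0. It is the cochain
    [tau_0|c0] + tau ([xi_1|xi_1|tau_1] + [xi_1|xi_1|tau_0 xi_1] +
    [xi_1|tau_0 xi_1|xi_1] + [tau_0 xi_1|xi_1|xi_1]); modulo rho the first
    term has coboundary tau [tau_0|xi_1|xi_1|xi_1], which the others cancel
    because h0 h1 = 0. *)
Definition a_form : formal_cob 3 :=
  map_leaves (fun L => [seq (t.1.1, 0%N, t.2) | t <- L & t.1.2 == 1%N]) (formal_d c0_form).

(** Terms with rho^2 have too high a filtration to matter, and tau^2 kills
    gamma / (rho^s tau^2). *)
Lemma d_c0_check : all (all (fun t => (2 <= t.1.2)%N || (2 <= t.1.1)%N))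
  (leaves (@cadd (formal_cob 3) (formal_d c0_form) (map_leaves (@crho cform) a_form))).
Proof. by vm_compute. Qed.

Definition word_code2 (m1 m2 : mon) : nat := (8 * mon_code m1 + mon_code m2)%N.

(** The generic multiple of tau in internal degree 6, that is, in stem 4;
    its ten monomials have weight 2. *)
Definition generic_deg6 : formal_cob 2 := chain2 (fun m1 m2 =>
  if (mon_deg m1 + mon_deg m2 == 6)%N then [:: (1, 0, word_code2 m1 m2)%N] else [::]).

(** Solving the cocycle condition by elimination leaves two free
    coefficients, say e at [xi_1 tau_1|tau_0] and f at [tau_0 tau_1|xi_1];
    the solution is (e + f) c0 plus f times the boundary of [tau_0 tau_1
    xi_1]. *)
Definition c0_coef : seq nat := [:: word_code2 mT1X mT0; word_code2 mT0T1 mX].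
Definition bound_deg6 : formal_cob 1 :=
  chain1 (fun m => if m == mT0T1X then [:: (1, 0, word_code2 mT0T1 mX)%N] else [::]).

Definition tau_parts (I : seq nat) n (X : formal_cob n) : seq (seq nat) :=
  flatten [seq [seq tau_part i L | i <- I] | L <- leaves X].
Definition killed_by (I : seq nat) (B : seq (seq nat)) (L : form) : bool :=
  all (fun t => (0 < t.1.2)%N || (t.1.1 \in I)) L && all
    (fun i => nilp (reduce B (tau_part i L))) I.

(** If the tau-part of the differential vanishes, then the generic cochain
    is a multiple of c0 plus a boundary, up to terms in rho. *)
Lemma deg6_check : let B := eliminate (tau_parts [:: 1%N] (formal_d generic_deg6)) in
  all (fun L => all (fun t => (0 < t.1.2)%N || (0 < t.1.1)%N) L && nilp
    (reduce B (tau_part 1 L)))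
  (leaves (@cadd (formal_cob 2) generic_deg6
    (@cadd (formal_cob 2) (map_leaves (subst_form c0_coef) c0_form)
    (formal_d bound_deg6)))).
Proof. by vm_compute. Qed.

Definition word_code3 (m1 m2 m3 : mon) : nat :=
  (64 * mon_code m1 + 8 * mon_code m2 + mon_code m3)%N.

(** The generic cochain of stem 4 and weight 2, where the weight fixes the
    power of tau; there are 51 monomials. *)
Definition generic_deg7 : formal_cob 3 := chain3 (fun m1 m2 m3 =>
  let w := (mon_wt m1 + mon_wt m2 + mon_wt m3)%N in
  if (mon_deg m1 + mon_deg m2 + mon_deg m3 == 7)%N && (2 <= w)%N
  then [:: (w - 2, 0, word_code3 m1 m2 m3)%N] else [::]).
Definition a_coef : seq nat := [:: word_code3 mT0 mT0 mT1X; word_code3 mT1X mT0 mT0;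
  word_code3 mT0 mT1X mT0].

(** A cocycle of this degree is the boundary of this cochain plus a multiple
    of a_form, the factor being the sum of the coefficients listed in
    a_coef. These coefficients come from inverting the matrix of the eight
    boundaries and of a_form on nine coordinates. *)
Definition bound_deg7_table : seq (mon * mon * seq nat) :=
  [:: (mX, mT1X, [:: word_code3 mT1 mT1 mT0; word_code3 mT1 mX mX; word_code3 mX mT1 mX]);
      (mT1, mT0T1, [:: word_code3 mT1 mT1 mT0]);
      (mT1X, mX, [:: word_code3 mT1 mT1 mT0; word_code3 mT1 mX mX]);
      (mT0, mT0T1X, [:: word_code3 mT0 mT0 mT1X]);
      (mT0X, mT0T1, [:: word_code3 mT1X mT0 mT0; word_code3 mT0X mT0X mT0]);
      (mT0T1, mT1, [:: word_code3 mT1 mT0 mT1; word_code3 mT1 mT1 mT0]);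
      (mT0T1, mT0X, [:: word_code3 mT0X mT0 mT0X]);
      (mT0T1X, mT0, [:: word_code3 mT1X mT0 mT0])].
Definition bound_deg7 : formal_cob 2 := chain2 (fun m1 m2 =>
  flatten [seq [seq ((mon_wt m1 + mon_wt m2 - 2)%N, 0%N, v) | v <- p.2] | p <-
    bound_deg7_table & p.1 == (m1, m2)]).

(** The cohomology in the degree of a has dimension at most one: the
    relations have rank 42 in 51 variables, and the boundaries have rank 8. *)
Lemma deg7_check : let B := eliminate (tau_parts [:: 0%N; 1%N] (formal_d generic_deg7)) in
  all (killed_by [:: 0%N; 1%N] B)
    (leaves (@cadd (formal_cob 3) generic_deg7
      (@cadd (formal_cob 3) (map_leaves (subst_form a_coef) a_form)
      (formal_d bound_deg7)))).
Proof. by vm_compute. Qed.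

Section LinearForms.
Variables (V : lmodType 'F_2) (c : nat -> V).
Definition eval_lin (l : seq nat) : V := \sum_(v <- l) c v.
Lemma eval_lin_reduce B L : (forall r, r \in B -> eval_lin r = 0) ->
  eval_lin (reduce B L) = eval_lin L.
Proof.
move=> B0; rewrite /reduce.
have -> : eval_lin L = eval_lin (xor_seq L [::]) by
  rewrite /eval_lin sum_xor_seq big_nil addr0.
elim: B (xor_seq L [::]) B0 => [|r B IHB] M B0 //=.
rewrite IHB => [|r' Br']; last by apply: B0; rewrite in_cons Br' orbT.
case: r B0 => // p r B0; case: ifP => // _.
by rewrite [LHS]sum_xor_seq -/(eval_lin _) B0 ?add0r // mem_head.
Qed.
Lemma eval_lin_eliminate R : (forall r, r \in R -> eval_lin r = 0) ->
  forall r, r \in eliminate R -> eval_lin r = 0.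
Proof.
rewrite /eliminate.
suff: forall B, (forall r, r \in B -> eval_lin r = 0) ->
  (forall r, r \in R -> eval_lin r = 0) ->
  forall r, r \in foldl (fun B r => let r' :=
    reduce B r in if nilp r' then B else rcons B r') B R -> eval_lin r = 0.
  by move=> H; apply: H.
elim: R => [|r R IHR] B B0 R0 //=; apply: IHR => [s|s Rs]; last by apply: R0;
  rewrite in_cons Rs orbT.
case: ifP => _; first exact: B0.
rewrite mem_rcons in_cons => /orP[/eqP ->|]; last exact: B0.
by rewrite eval_lin_reduce //; apply: R0; rewrite mem_head.
Qed.
Lemma eval_lin_eq0 R l : (forall r, r \in R -> eval_lin r = 0) ->
  nilp (reduce (eliminate R) l) -> eval_lin l = 0.
Proof.
move=> R0 /nilP l0; rewrite -(eval_lin_reduce l (eval_lin_eliminate R0)) l0.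
by rewrite /eval_lin big_nil.
Qed.
End LinearForms.

Lemma tau_partsP I n (X : formal_cob n) (Q : seq nat -> Prop) :
  (forall L i, L \in leaves X -> i \in I -> Q (tau_part i L)) ->
  forall r, r \in tau_parts I X -> Q r.
Proof. by move=> QI r /flatten_mapP[L LX /mapP[i iI ->]]; exact: QI. Qed.

(** The evaluation of a formal cochain after an operation on its forms is an
    evaluation at other values of the symbols. *)
Lemma eval_chain_map (N : rtmod) (val val' : nat -> N) (f : form -> form) n
  (X : formal_cob n) :
  (forall L, eval_form val (f L) = eval_form val' L) ->
    eval_chain val (map_leaves f X) = eval_chain val' X.
Proof.
move=> fE; elim: n X => [|n IHn] X; first exact: fE.
by apply/ffunP=> m; rewrite !ffunE get_tab; exact: IHn.
Qed.

Lemma eval_form_rho (N : rtmod) (val : nat -> N) L :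
  eval_form val (@crho cform L) = eval_form (rt_rho N \o val) L.
Proof. by rewrite /eval_form big_map; apply: eq_bigr => t _; congr (iter _ _ _);
  exact: iterSr. Qed.

Lemma iter_additive (U : zmodType) (g : {additive U -> U}) k :
  {morph iter k g : x y / x + y}.
Proof. by move=> x y; elim: k => //= k ->; rewrite raddfD. Qed.

Lemma sum_eval_term (N : rtmod) (val : nat -> N) i r (l : seq nat) :
  \sum_(v <- l) eval_term val (i, r, v) = iter i (rt_tau N)
    (iter r (rt_rho N) (eval_lin val l)).
Proof.
have it0 k (g : {additive N -> N}) : iter k g 0 = 0.
  by elim: k => //= k ->; rewrite raddf0.
rewrite /eval_lin; elim: l => [|v l IHl]; first by rewrite !big_nil !it0.
by rewrite !big_cons IHl !iter_additive.
Qed.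

Lemma eval_form_subst (N : rtmod) (val : nat -> N) (l : seq nat) L :
  eval_form val (subst_form l L) = eval_form (fun=> eval_lin val l) L.
Proof.
rewrite /eval_form /subst_form; elim: L => [|t L IHL] /=; first by rewrite !big_nil.
by rewrite big_cat big_cons IHL big_map; congr (_ + _); case: t => [[i r] v];
  exact: sum_eval_term.
Qed.

(** * The torsion summand *)

Lemma mul_gam_tau_pred j k (p : Ftau) : mul_gam j k (rt_tau Ftau p) = mul_gam j k.-1 p.
Proof.
rewrite mul_gam_tau !(@mul_gamE _ _ _ p (leqnn _)) raddf_sum; apply: eq_bigr => i _.
rewrite [LHS](linearZ_LR (rt_tau NC)) [rt_tau _ _]tau_gam; congr (_ *: gam _ _).
by rewrite -!subn1 subnAC.
Qed.

Lemma mul_gam_gam0 j (p : Ftau) : mul_gam j 0 p = 0.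
Proof. by rewrite (@mul_gamE _ _ _ p (leqnn _)) big1 // => i _; rewrite sub0n scaler0. Qed.

Lemma cob_Ftau_rho n (x : cob Ftau n) : rt_rho (cob Ftau n) x = 0.
Proof. by elim: n x => [|n IHn] x //; apply/ffunP=> m; rewrite !ffunE IHn. Qed.

(** As rho is zero, the right unit of tau is tau. *)
Lemma cob_Ftau_tau n (x : cob Ftau n.+1) : rt_tau (cob Ftau n.+1) x = cwise
  (rt_tau (cob Ftau n)) x.
Proof.
rewrite /= /tau_r -[RHS]addr0; congr (_ + _).
by apply/ffunP=> m; rewrite !ffunE cob_Ftau_rho.
Qed.

Lemma gam_tens_tau j k n (x : cob Ftau n) : gam_tens j k (rt_tau (cob Ftau n) x) =
  gam_tens j k.-1 x.
Proof.
elim: n x => [|n IHn] x; first exact: mul_gam_tau_pred.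
rewrite cob_Ftau_tau; apply/ffunP=> m; rewrite [LHS]ffunE [RHS]ffunE.
by apply: etrans (IHn ((x : {ffun mon -> cob Ftau n}) m)); congr gam_tens; exact: ffunE.
Qed.
Lemma gam_tens_iter j k i n (x : cob Ftau n) :
  gam_tens j k (iter i (rt_tau (cob Ftau n)) x) = gam_tens j (k - i) x.
Proof.
elim: i k => [|i IHi] k; first by rewrite subn0.
by rewrite iterS gam_tens_tau IHi -subn1 subnAC subn1 -subnS.
Qed.
Lemma gam_tens0 j n (x : cob Ftau n) : gam_tens j 0 x = 0.
Proof.
elim: n x => [|n IHn] x; first exact: mul_gam_gam0.
by apply/ffunP=> m; rewrite [LHS]ffunE [RHS]ffunE; exact: IHn.
Qed.

Lemma dC_tau n (x : cob Ftau n) : dC n (rt_tau (cob Ftau n) x) = rt_tau (cob Ftau n.+1)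
  (dC n x).
Proof.
have E : unit_r (rt_tau (cob Ftau n) x) = rt_tau (cob Ftau n.+1) (unit_r x).
  by rewrite [RHS]tau_r_unit cob_Ftau_rho raddf0 raddf0 addr0.
rewrite /dC /= /cob_d E raddfD; congr (_ + _).
exact/(@eq_mod_eq0 (cob Ftau n.+1))/(morph_tau (morph_inner comodule_Ftau n)).
Qed.
Lemma dC_iter_tau n i (x : cob Ftau n) :
  dC n (iter i (rt_tau (cob Ftau n)) x) = iter i (rt_tau (cob Ftau n.+1)) (dC n x).
Proof. by elim: i => //= i IHi; rewrite -IHi; exact: dC_tau. Qed.

Lemma cob_Ftau_tau_inj n : injective (rt_tau (cob Ftau n)).
Proof.
elim: n => [|n IHn] x y; first by move/(mulfI (monic_neq0 (monicX _))).
by rewrite !cob_Ftau_tau => /ffunP E; apply/ffunP=> m; apply: IHn; have := E m;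
  rewrite !ffunE.
Qed.

Lemma mcoeff_mul_gam s K (p : Ftau) i : monalg.mcoeff (s, i) (mul_gam s K p : NCspace) =
  if (i < K)%N then (p : {poly 'F_2})`_(K.-1 - i) else 0.
Proof.
pose n := maxn (size (p : {poly 'F_2})) K.
rewrite (@mul_gamE _ _ n) ?leq_maxl // raddf_sum /=.
under eq_bigr => l _ do rewrite monalg.mcoeffZ mcoeff_gam eqxx /=.
case: ltnP => [lt_i|le_K]; last first.
  rewrite big1 // => l _; case: eqP => [E|]; last by rewrite mulr0.
  by have := leq_subr l K; rewrite E ltnNge le_K.
have lt_n : (K.-1 - i < n)%N by rewrite /n; lia.
rewrite (bigD1 (Ordinal lt_n)) //= big1 ?addr0 => [|l ne_l].
  by rewrite (_ : (K - (K.-1 - i) == i.+1)%N) ?mulr1 //; lia.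
case: eqP => [E|]; last by rewrite mulr0.
by case/eqP: ne_l; apply/val_inj => /=; lia.
Qed.

Lemma opp_ltS (s j : nat) : j != s -> (- s%:Z <= - j%:Z :> int) ->
  (- s%:Z + 1 <= - j%:Z :> int).
Proof. lia. Qed.

Lemma mul_gam_onto s (x : NC) : filNC_mem (- s%:Z) x ->
  exists K0, forall K, (K0 <= K)%N -> exists p : Ftau,
    filNC_mem (- s%:Z + 1) (x - mul_gam s K p).
Proof.
move=> Fx; exists (\max_(t <- monalg.msupp (x : NCspace)) t.2.+1)%N => K leK.
(* The symbol with tau^(i+1) in the denominator is tau^(K-1-i) times the one
   with tau^K. *)
exists (\poly_(i < K) monalg.mcoeff (s, (K.-1 - i)%N) (x : NCspace)) => j i.
set y := _ - _ => yji.
have le_js : - s%:Z <= - j%:Z :> int.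
  by apply: (@fil_memB _ 0 x (mul_gam s K _) Fx) yji; exact: mul_gam_fil.
have [js|ne_js] := eqVneq j s; last exact: opp_ltS.
exfalso; move: yji; rewrite js.
rewrite /y monalg.mcoeffB mcoeff_mul_gam => /eqP; apply.
case: ltnP => [lt_i|le_K].
  rewrite coef_poly ifT; last by lia.
  by rewrite (_ : (K.-1 - (K.-1 - i))%N = i) ?subrr //; lia.
rewrite subr0; apply: monalg.mcoeff_outdom; apply/negP => si.
have := @leq_bigmax_seq _ (enum_fset (monalg.msupp (x : NCspace))) xpredT
  (fun t => t.2.+1) (s, i) si isT.
by rewrite /= => lti; have := leq_trans lti leK; rewrite ltnNge le_K.
Qed.

(** Finitely many symbols occur in v, so they have a common denominator. *)
Lemma gam_tens_onto s n (v : cob NC n) : fil_mem (- s%:Z) v ->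
  exists K0, forall K, (K0 <= K)%N ->
    exists w : cob Ftau n, fil_mem (- s%:Z + 1) (v - gam_tens s K w).
Proof.
elim: n v => [|n IHn] v Fv; first exact: mul_gam_onto.
have [K0 HK] := choice (fun m => IHn _ (Fv m)).
exists (\max_m K0 m)%N => K leK.
have [w Hw] := choice (fun m => HK m K (leq_trans (leq_bigmax m) leK)).
by exists [ffun m => w m] => m; rewrite !ffunE; exact: Hw.
Qed.

Lemma gam_tens_kernel s K n (y : cob Ftau n) : fil_mem (- s%:Z + 1) (gam_tens s K y) ->
  exists y', y = iter K (rt_tau (cob Ftau n)) y'.
Proof.
elim: n y => [|n IHn] y Fy.
  have y0 l : (l < K)%N -> (y : {poly 'F_2})`_l = 0.
    move=> lt_l; apply/eqP; apply: contraT => yl.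
    have := Fy s (K.-1 - l)%N; rewrite [gam_tens _ _ _]/= mcoeff_mul_gam ifT; last by lia.
    by rewrite (_ : (K.-1 - (K.-1 - l))%N = l); [move/(_ yl); lia | lia].
  exists (drop_poly K (y : {poly 'F_2})).
  have -> : forall p : Ftau, iter K (rt_tau Ftau) p = 'X^K * (p : {poly 'F_2}).
    by move=> p; elim: (K) => [|i IHi]; rewrite ?mul1r // iterS IHi /= /tau_poly
      mulrA -exprS.
  rewrite mulrC -[LHS](poly_take_drop K) [take_poly _ _](_ : _ = 0) ?add0r //.
  by apply/polyP=> l; rewrite coef_take_poly coef0; case: ifP => // /y0.
have [w Hw] := choice (fun m => IHn ((y : {ffun mon -> cob Ftau n}) m)
  (ltac:(by have := Fy m; rewrite ffunE))).
exists [ffun m => w m]; apply/ffunP=> m; rewrite Hw.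
have -> : forall x : cob Ftau n.+1, iter K (rt_tau (cob Ftau n.+1)) x = cwise
  (iter K (rt_tau (cob Ftau n))) x.
  move=> x; elim: (K) => [|i IHi]; first by apply/ffunP=> l; rewrite ffunE.
  by rewrite iterS IHi cob_Ftau_tau; apply/ffunP=> l; rewrite !ffunE.
by rewrite !ffunE.
Qed.

Lemma iter_injective (T : Type) (f : T -> T) k : injective f -> injective (iter k f).
Proof. by move=> inj_f; elim: k => [|k IHk] x y // /inj_f /IHk. Qed.

(** The projection to Tor_1 is only described on representatives. If gamma /
    (rho^s tau^k) c is a boundary, write it over a common denominator tau^K;
    then tau^(K-k) c = d w + tau^K y for some w and y, hence tau^K z = tau^K
    d y, and z = d y as the cobar complex has no tau-torsion. *)
Lemma Tor_proj_eq0 s n (x : Eminus 1 s n.+1) y : Tor_proj x y -> x = 0 -> y = 0.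
Proof.
case=> k [c [z [dz dc -> ->]]] x0.
have Zc : Zr dNC fil 1 (- s%:Z) n.+1 (gam_tens s k c).
  by apply: Zr_gam_tens; rewrite dc gam_tens_iter subnn gam_tens0.
have Bc : Br dNC fil 1 (- s%:Z) n.+1 (gam_tens s k c).
  rewrite -[gam_tens s k c]subr0; apply/(clsP _ Zc); first exact: sg_mem0.
  by rewrite cls0.
have [u [v [Fu Fv E]]] := BrS Bc.
have [K0 HK] := gam_tens_onto Fv.
pose K := maxn K0 k; have [w Fw] := HK K (leq_maxl _ _).
pose tauK i := iter i (rt_tau (cob Ftau n.+1)).
have [y' Ey'] : exists y', tauK (K - k)%N c - dC n w = tauK K y'.
  apply: (@gam_tens_kernel s).
  have A : gam_tens s K (tauK (K - k)%N c) = u + dNC n v.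
    by rewrite -E gam_tens_iter subKn // leq_maxr.
  have -> : gam_tens s K (tauK (K - k)%N c - dC n w) = u + dNC n v - gam_tens s K (dC n w).
    by rewrite -A -[in RHS](subrK (dC n w) (tauK _ c)) [in RHS]gam_tensD addrK.
  have -> : dNC n v = dNC n (v - gam_tens s K w) + dNC n (gam_tens s K w).
    by rewrite -raddfD subrK.
  have regroup (V : zmodType) (e f g h : V) : e + (f + g) - h = e + (f + (g - h)).
    by rewrite -!addrA.
  rewrite regroup.
  have FD := stableD (stable_liftn n.+1 (stable_fil (- s%:Z + 1))).
  apply/fil_liftn/FD; first exact/fil_liftn.
  apply: FD; first by apply/fil_liftn; exact: (dNC_fil Fw).
  by apply/fil_liftn; exact: gam_tens_d.
rewrite -[RHS](cls0 (cocycle dC n.+2) (coboundary dC n.+2)); apply/clsC_eq => //;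
  first exact: raddf0.
exists y' => //; rewrite subr0.
have tau_inj : injective (iter K (rt_tau (cob Ftau n.+2))).
  by apply: iter_injective; exact: cob_Ftau_tau_inj.
have dE : dC n.+1 (tauK (K - k)%N c - dC n w) = dC n.+1 (tauK (K - k)%N c).
  by rewrite raddfB [X in _ - X](dC_dC w) subr0.
apply: tau_inj; rewrite -dC_iter_tau -/(tauK K y') -Ey' dE dC_iter_tau dc -iterD.
by rewrite subnK // leq_maxr.
Qed.

(** * The two differentials on explicit cochains *)

Lemma iter_rho_gam r j k : iter r (rt_rho NC) (gam j k) = if (r <= j)%N then gam (j - r) k
  else 0.
Proof.
elim: r => [|r IHr]; first by rewrite subn0.
rewrite iterS IHr; case: (leqP r j) => [le_rj|lt_jr]; last first.
  by rewrite raddf0; case: ltnP => // lt_rj; lia.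
rewrite [rt_rho _ _]rho_gam; case: ltnP => [lt_rj|le_jr].
  by rewrite subnS; case: (j - r)%N (subn_gt0 r j) => //; rewrite lt_rj.
by rewrite (_ : (j - r)%N = 0%N) //; lia.
Qed.

Lemma iter_tau_rho_gam s k i r : iter i (rt_tau NC) (iter r (rt_rho NC) (gam s k)) =
  if (r <= s)%N then gam (s - r) (k - i) else 0.
Proof.
rewrite iter_rho_gam; case: ifP => _; first exact: iter_tau_gam.
by elim: i => //= i ->; exact: raddf0.
Qed.

Lemma fil_iter_tau_rho_gam p s k i r : p <= - s%:Z + r%:Z :> int ->
  filNC_mem p (iter i (rt_tau NC) (iter r (rt_rho NC) (gam s k))).
Proof.
move=> le_p; rewrite iter_tau_rho_gam; case: ifP => le_rs;
  last exact: (stable0 (stable_fil p)).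
by apply: fil_gam; lia.
Qed.

Lemma psi_gam2_unit s (c : 'F_2) p : p <= - s%:Z + 2 :> int ->
  eq_mod (@liftn NC (filNC_mem p) 1) (psi_NC (c *: gam s 2)) (unit_r (c *: gam s 2 : NC)).
Proof.
move=> le_p; have S1 := stable_liftn 1 (stable_fil p).
case: (F2P c) => ->; first by rewrite scale0r !raddf0; exact: (eq_mod_refl S1).
by rewrite scale1r => m; apply: (fil_leq le_p); exact: (@psi_NC_even s 1 m).
Qed.

(** The second differential on cochains: with g = gamma / (rho^(1+j) tau^2),
    which is primitive modulo rho^2, the differential of tau g c0 is rho g
    times the cochain a_form, and rho g is gamma / (rho^j tau^2). *)
Lemma d_c0_form j : fil_mem (- j%:Z + 1)
  (dNC 2 (eval_chain (fun=> gam (1 + j) 2 : NC) c0_form) - gam_tens j 2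
    (eval_chain (fun=> (1 : {poly 'F_2}) : Ftau) a_form)).
Proof.
set p : int := _ + 1; have Sp := stable_fil p; have S3 := stable_liftn 3 Sp.
pose val (v : nat) : NC := gam (1 + j) 2.
apply/fil_liftn; rewrite -/(eq_mod _ _ _).
have valP v : eq_mod (@liftn NC (filNC_mem p) 1) (psi_NC (val v)) (unit_r (val v)).
  by rewrite -[val v]scale1r; apply: psi_gam2_unit; rewrite /p; lia.
apply: (eq_mod_trans S3 (eval_d comodule_NC Sp valP c0_form)).
apply: (@eq_mod_trans _ _ S3 (@eval_chain NC val 3 (map_leaves (@crho cform) a_form))).
  rewrite /eq_mod -[X in _ - X]oppx opprK -(evaluationD (eval_chainP val 3)).
  apply: eval_chain_leaves => L LX; have /allP/(_ L LX)/allP badL := d_c0_check.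
  rewrite /eval_form big_seq; elim/big_ind: _ => [||t tL];
    [exact: (stable0 Sp) | exact: (stableD Sp) |].
  case/orP: (badL t tL) => le2; first by apply: fil_iter_tau_rho_gam; rewrite /p; lia.
  rewrite /eval_term iter_tau_rho_gam; case: ifP => _; last exact: (stable0 Sp).
  by move: le2; rewrite -subn_eq0 => /eqP ->; exact: (stable0 Sp).
have -> : @eval_chain NC val 3 (map_leaves (@crho cform) a_form) = eval_chain
  (fun=> gam j 2 : NC) a_form.
  apply: eval_chain_map => L; rewrite eval_form_rho /eval_form; apply: eq_bigr => t _.
  by congr (iter _ _ (iter _ _ _)); exact: (rho_gam j.+1 2).
apply: (@eq_mod_sym _ (@liftn NC (filNC_mem p) 3)); rewrite gam_tensE.
have := @morph_eval_chain _ _ _ _ Sp (morph_mul_gam j 2) (fun=> (1 : {poly 'F_2}) : Ftau)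
  3 a_form.
have -> // : mul_gam j 2 \o (fun=> 1 : {poly 'F_2}) = (fun=> gam j 2) :> (nat -> NC).
by apply/funext => v; rewrite /= /mul_gam /tau_eval size_poly1 big_ord1 coef1 scale1r.
Qed.

Lemma mul_gam1 j k : mul_gam j k (1 : {poly 'F_2}) = gam j k.
Proof. by rewrite /mul_gam /tau_eval size_poly1 big_ord1 coef1 scale1r. Qed.

Definition tau0_chain : cob Ftau 1 :=
  [ffun m : mon => if m == mT0 then (1 : {poly 'F_2}) else 0].

(** The only cochains of the degree of h0 are the multiples of [tau_0]. *)
Lemma h0_eq_tau0 (h0 : ExtC 1) : degC 0 0 h0 -> h0 <> 0 ->
  dC 1 tau0_chain = 0 /\ h0 = clsC tau0_chain.
Proof.
case=> z [dz degz h0z] h0_neq0.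
pose y (m : mon) : {poly 'F_2} := (z : {ffun mon -> {poly 'F_2}}) m.
have y0 m i : (y m)`_i != 0 -> (m == mT0) && (i == 0%N).
  move=> /(degz m i); case: m => [[[] []] []] []; rewrite /mon_deg /mon_wt /=; lia.
have zE : z = [ffun m : mon => if m == mT0 then ((y mT0)`_0)%:P else 0].
  apply/ffunP=> m; rewrite ffunE -[LHS]/(y m); apply/polyP=> i.
  have [yi|/y0/andP[/eqP -> /eqP ->]] := eqVneq (y m)`_i 0; last by rewrite eqxx coefC.
  rewrite yi; case: eqP => [mT|_]; last by rewrite coef0.
  by rewrite coefC; have [i0|//] := eqVneq i 0%N; move: yi; rewrite i0 mT => ->.
case: (F2P (y mT0)`_0) => c; rewrite c in zE.
  case: h0_neq0; rewrite h0z (_ : z = 0); first exact: cls0.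
  by rewrite zE; apply/ffunP=> m; rewrite !ffunE if_same.
have -> : tau0_chain = z by rewrite zE.
by [].
Qed.

Lemma mul_tau0_unit (N : rtmod) (y : N) :
  mul_tau0 (unit_r y) = [ffun m : mon => if m == mT0 then y else 0].
Proof.
apply/ffunP=> -[[e0 e1] ex]; rewrite !ffunE /=.
by case: e0; case: e1; case: ex; rewrite /= ?raddf0 ?addr0.
Qed.

(** The first differential on cochains: gamma / (rho^(1+j) tau^(2k+1)) is
    tau times an element that is primitive modulo rho^2, and eta_R(tau) =
    tau + rho tau_0. *)
Lemma d_gam_odd j k : fil_mem (- j%:Z + 1)
  (dNC 0 (gam (1 + j) (2 * k + 1) : NC) - gam_tens j (2 * k + 2) tau0_chain).
Proof.
set p : int := _ + 1; have Sp := stable_fil p; have S1 := stable_liftn 1 Sp.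
pose g : NC := gam (1 + j) k.+1.*2.
have gE : gam (1 + j) (2 * k + 1) = rt_tau NC g.
  by rewrite [RHS]tau_gam; congr gam; lia.
have -> : gam_tens j (2 * k + 2) tau0_chain = mul_tau0 (unit_r (rt_rho NC g)).
  have -> : rt_rho NC g = gam j (2 * k + 2).
    by rewrite [LHS](rho_gam j.+1); congr gam; lia.
  have u0 : mul_gam j (2 * k + 2) (0 : {poly 'F_2}) = 0 by
    rewrite /mul_gam /tau_eval size_poly0 big_ord0.
  rewrite mul_tau0_unit; apply/ffunP=> m; rewrite [LHS]ffunE [RHS]ffunE.
  have -> : tau0_chain m = if m == mT0 then 1 else 0 by rewrite ffunE.
  by case: ifP => _; [exact: mul_gam1 | exact: u0].
apply/fil_liftn; rewrite -/(eq_mod _ _ _).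
have psig : eq_mod (@liftn NC (filNC_mem p) 1) (psi_NC g) (unit_r g).
  move=> m; apply: (@fil_leq (- (1 + j)%N%:Z + 2)); first by rewrite /p; lia.
  exact: (@psi_NC_even (1 + j) k.+1 m).
have := eq_mod_tau S1 psig; rewrite -(comodule_tau comodule_NC) -gE => psiE.
have -> : mul_tau0 (unit_r (rt_rho NC g)) = rt_tau (tensA NC) (unit_r g) + unit_r
  (rt_tau NC g).
  by rewrite [rt_tau _ _]tau_r_unit addrAC addxx add0r.
by rewrite -gE; apply: (eq_modD S1 psiE); exact: (eq_mod_refl S1).
Qed.

(** * Cochains of the degrees of Q and a *)

Lemma iter_scale (V : lmodType 'F_2) (f : {linear V -> V}) k e x :
  iter k f (e *: x) = e *: iter k f x.
Proof. by elim: k => // k IHk; rewrite !iterS IHk linearZ. Qed.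

Section LeafNC.
Variables (s : nat) (c : nat -> ('F_2)^o).
Local Notation val := (fun v => c v *: gam s 2 : NC).

Lemma eval_term_gam i r v : eval_term val (i, r, v) = c v *:
  (if (r <= s)%N then gam (s - r) (2 - i) else 0 : NC).
Proof.
rewrite -iter_tau_rho_gam -!iter_scale; exact: erefl.
Qed.

(** Among the multiples of gamma / (rho^s tau^2) by tau^i rho^r, only the
    one by tau contributes to gamma / (rho^s tau). *)
Lemma mcoeff_eval_form (L : form) :
  monalg.mcoeff (s, 0%N) (eval_form val L : NCspace) = eval_lin c (tau_part 1 L).
Proof.
rewrite /eval_form /eval_lin /tau_part big_map big_filter [RHS]big_mkcond raddf_sum.
apply: eq_bigr => -[[i r] v] _; rewrite eval_term_gam /= monalg.mcoeffZ.
case: leqP => [le_rs|lt_sr]; last first.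
  by rewrite monalg.mcoeff0 mulr0 ifF //; apply/negP => /andP[_ /eqP r0]; lia.
rewrite mcoeff_gam; case: ifP => [/andP[/eqP -> /eqP ->]|ir]; first by
  rewrite subn0 eqxx mulr1.
by case: andP => [[/eqP r0 /eqP i1]|]; [lia | rewrite mulr0].
Qed.

Lemma fil_eval_form (L : form) : all (fun t => (0 < t.1.2)%N || (0 < t.1.1)%N) L ->
  eval_lin c (tau_part 1 L) = 0 -> filNC_mem (- s%:Z + 1) (eval_form val L).
Proof.
set p : int := _ + 1; have Sp := stable_fil p.
move=> /allP posL; rewrite /eval_lin /tau_part big_map big_filter => ev0.
rewrite /eval_form (bigID (fun t => (t.1.1 == 1%N) && (t.1.2 == 0%N))) /=.
have -> : \sum_(t <- L | (t.1.1 == 1%N) && (t.1.2 == 0%N)) eval_term val t = 0.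
  transitivity ((\sum_(t <- L | (t.1.1 == 1%N) && (t.1.2 == 0%N)) c t.2) *:
    (gam s 1 : NC)); last first.
    by rewrite [X in X *: _]ev0 scale0r.
  rewrite scaler_suml; apply: eq_bigr => -[[i r] v] /= /andP[/eqP -> /eqP ->].
  by rewrite eval_term_gam leq0n subn0.
rewrite add0r big_seq_cond; elim/big_ind: _ => [||[[i r] v]];
  [exact: (stable0 Sp) | exact: (stableD Sp) |].
rewrite /= => /andP[/posL /= pos_ir not_10]; rewrite eval_term_gam.
case: (F2P (c v)) => ->; first by rewrite scale0r; exact: (stable0 Sp).
rewrite scale1r; case: leqP => [le_rs|_]; last exact: (stable0 Sp).
case: (posnP r) => [r0|r_gt0]; last by apply: fil_gam; rewrite /p; lia.
by rewrite (_ : (2 - i)%N = 0%N); [exact: (stable0 Sp) | lia].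
Qed.
End LeafNC.

Lemma word_decode2 m1 m2 : (mon_decode (word_code2 m1 m2 %/ 8) = m1) *
  (mon_decode (word_code2 m1 m2 %% 8) = m2).
Proof. by case: m1 => [[[] []] []]; case: m2 => [[[] []] []]. Qed.

Lemma wt_deg6 m1 m2 : (mon_deg m1 + mon_deg m2 = 6 -> mon_wt m1 + mon_wt m2 = 2)%N.
Proof. by case: m1 => [[[] []] []]; case: m2 => [[[] []] []]. Qed.

(** An element of the degree of (Q / rho^s) h1^3 has, modulo higher
    filtration, only the ten coefficients of stem 4 and weight 2, all of
    them multiples of gamma / (rho^s tau). The cocycle condition on the
    first page then leaves a multiple of c0 up to boundaries. In particular
    an ambiguity of the lift by classes of the tensor product summand does
    not arise. *)
Lemma E1_degree_lift s (z : cob NC 2) :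
  Zr dNC fil 1 (- s%:Z) 2 z -> cob_deg deg_NC (4 + s)%N%:Z (4 + s)%N%:Z z ->
  exists (e : 'F_2) (y : cob NC 1), fil_mem (- s%:Z) y /\
    fil_mem (- s%:Z + 1) (z - (eval_chain (fun=> e *: (gam s 2 : NC)) c0_form + dNC 1 y)).
Proof.
move=> [Fz Fdz] degz; set p : int := - s%:Z + 1 in Fdz *.
have Sp := stable_fil p.
pose zc (m1 m2 : mon) : NC := ((z : {ffun mon -> cob NC 1}) m2 : {ffun mon -> NC}) m1.
pose c (v : nat) : ('F_2)^o := monalg.mcoeff (s, 0%N)
  (zc (mon_decode (v %/ 8)) (mon_decode (v %% 8)) : NCspace).
pose val (v : nat) : NC := c v *: gam s 2.
have valP v : eq_mod (@liftn NC (filNC_mem p) 1) (psi_NC (val v)) (unit_r (val v)).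
  by apply: psi_gam2_unit; rewrite /p; lia.
have Fval v : filNC_mem (- s%:Z) (val v).
  rewrite /val; case: (F2P (c v)) => ->; rewrite ?scale0r ?scale1r; last exact: fil_gam.
  exact: (stable0 (stable_fil _)).
have zX : fil_mem p (z - eval_chain val generic_deg6).
  move=> m2 m1; rewrite !ffunE !get_tab -/(zc m1 m2) => j i.
  set x := (X in _ - X) => yji.
  have xE : x = if (mon_deg m1 + mon_deg m2 == 6)%N then monalg.mcoeff (s, 0%N)
    (zc m1 m2 : NCspace) *: (gam s 1 : NC) else 0.
    rewrite /x; case: ifP => _; rewrite /= /eval_form ?big_nil // big_cons big_nil addr0.
    by rewrite (eval_term_gam s c) leq0n subn0 /c !word_decode2.
  rewrite monalg.mcoeffB xE in yji.
  have [yji0|yji1] := eqVneq (monalg.mcoeff (j, i) (zc m1 m2 : NCspace)) 0.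
    exfalso; move: yji; rewrite yji0 sub0r oppr_eq0.
    case: ifP => [/eqP deg6|_]; last by rewrite monalg.mcoeff0 eqxx.
    rewrite monalg.mcoeffZ mcoeff_gam; case: andP => [[/eqP js /eqP i0]|_]; last by
      rewrite mulr0 eqxx.
    by case: i0 => i0; move: yji0; rewrite -js -i0 => ->; rewrite mul0r eqxx.
  have [] := degz m2 m1 j i yji1; have := Fz m2 m1 j i yji1.
  have [js|ne_js] := eqVneq j s; last by move: ne_js; rewrite /p; lia.
  move=> _ degE wtE; exfalso.
  have deg6 : (mon_deg m1 + mon_deg m2 = 6)%N by lia.
  have wt2 := wt_deg6 deg6; have i0 : i = 0%N by lia.
  by move: yji; rewrite deg6 eqxx js i0 monalg.mcoeffZ mcoeff_gam !eqxx mulr1 subrr eqxx.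
have Fd : fil_mem p (eval_chain val (formal_d generic_deg6)).
  apply/fil_liftn; apply: (@eq_mod_mem _ (@liftn NC (filNC_mem p) 3) (stable_liftn 3 Sp) _
    (dNC 2 (eval_chain val generic_deg6))).
    apply: (@eq_mod_sym _ (@liftn NC (filNC_mem p) 3));
      exact: (eval_d comodule_NC Sp valP generic_deg6).
  apply/fil_liftn; rewrite -[eval_chain val generic_deg6](subKr z) raddfB.
  exact: (@fil_memB p 3 _ _ Fdz (dNC_fil zX)).
have rels r : r \in tau_parts [:: 1%N] (formal_d generic_deg6) -> eval_lin c r = 0.
  move: r; apply: tau_partsP => L i LX; rewrite mem_seq1 => /eqP ->.
  rewrite -(mcoeff_eval_form s); move/fil_liftn/leaves_eval_chain: Fd => /(_ L LX) FL.
  by apply/eqP; apply: contraT => /FL; rewrite /p; lia.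
pose E := @eval_chain NC val 2 (map_leaves (subst_form c0_coef) c0_form).
exists (eval_lin c c0_coef), (eval_chain val bound_deg6); split.
  by apply/fil_liftn; exact: (stable_eval_chain (stable_fil _)).
have EE : E = eval_chain (fun=> eval_lin c c0_coef *: (gam s 2 : NC)) c0_form.
  have vE : eval_lin val c0_coef = eval_lin c c0_coef *: (gam s 2 : NC) by
    rewrite /eval_lin scaler_suml.
  by rewrite /E -vE; apply: (@eval_chain_map NC val (fun=> eval_lin val c0_coef)
    (subst_form c0_coef) 2 c0_form) => L; exact: eval_form_subst.
rewrite -EE; apply/fil_liftn.
apply: (@eq_mod_trans _ _ (stable_liftn 2 Sp) (eval_chain val generic_deg6));
  first exact/fil_liftn.
apply: (@eq_mod_trans _ _ (stable_liftn 2 Sp) (E + eval_chain val (formal_d bound_deg6)));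
  last first.
  apply: (eq_modD (stable_liftn 2 Sp)); first exact: (eq_mod_refl (stable_liftn 2 Sp)).
  apply: (@eq_mod_sym _ (@liftn NC (filNC_mem p) 2));
    exact: (eval_d comodule_NC Sp valP bound_deg6).
rewrite /E -(evaluationD (eval_chainP val 2)) /eq_mod -[X in _ - X]oppx
  opprK -(evaluationD (eval_chainP val 2)).
apply: eval_chain_leaves => L LX; have /allP/(_ L LX)/andP[posL redL] := deg6_check.
exact: (@fil_eval_form s c L posL (eval_lin_eq0 rels redL)).
Qed.

Section LeafFtau.
Variable c : nat -> ('F_2)^o.
Local Notation val := (fun v => (c v)%:P : Ftau).

Lemma iter_tau_poly i (p : Ftau) : iter i (rt_tau Ftau) p = 'X^i * (p : {poly 'F_2}) :>
  {poly 'F_2}.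
Proof. by elim: i => [|i IHi]; rewrite ?mul1r // iterS IHi /= /tau_poly mulrA -exprS. Qed.

Lemma coef_eval_form (L : form) k : (eval_form val L : {poly 'F_2})`_k = eval_lin c
  (tau_part k L).
Proof.
rewrite /eval_form /eval_lin /tau_part big_map big_filter [RHS]big_mkcond coef_sum.
apply: eq_bigr => -[[i r] v] _ /=.
rewrite /eval_term [iter _ _ _]iter_tau_poly coefXnM; case: r => [|r] /=; last first.
  by rewrite /rho_poly coef0 if_same andbF.
rewrite coefC andbT; case: ltngtP => [//|lt_ik|->]; last by rewrite subnn.
by rewrite subn_eq0 leqNgt lt_ik.
Qed.
End LeafFtau.

Lemma word_decode3 m1 m2 m3 : (mon_decode (word_code3 m1 m2 m3 %/ 64) = m1)
  * (mon_decode (word_code3 m1 m2 m3 %/ 8 %% 8) = m2) *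
    (mon_decode (word_code3 m1 m2 m3 %% 8) = m3).
Proof.
by case: m1 => [[[] []] []]; case: m2 => [[[] []] []]; case: m3 => [[[] []] []].
Qed.

(** The coefficients of z, put in place of the symbols, satisfy the
    relations solved in deg7_check. *)
Lemma cocycle_degree_a (z : cob Ftau 3) : dC 3 z = 0 -> cob_deg deg_Ftau 4 2 z ->
  exists (e : 'F_2) (y : cob Ftau 2), z = eval_chain (fun=> e%:P : Ftau) a_form + dC 2 y.
Proof.
move=> dz degz.
pose zc (m1 m2 m3 : mon) : {poly 'F_2} :=
  (((z : {ffun mon -> cob Ftau 2}) m3 : {ffun mon -> cob Ftau 1}) m2 :
    {ffun mon -> {poly 'F_2}}) m1.
pose wt3 (m1 m2 m3 : mon) := (mon_wt m1 + mon_wt m2 + mon_wt m3)%N.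
pose coef (m1 m2 m3 : mon) : 'F_2 := (zc m1 m2 m3)`_(wt3 m1 m2 m3 - 2).
pose c (v : nat) : ('F_2)^o := coef (mon_decode (v %/ 64)) (mon_decode (v %/ 8 %% 8))
  (mon_decode (v %% 8)).
pose val (v : nat) : Ftau := (c v)%:P.
have S0 := stable_eq0 Ftau.
have dval n (X : formal_cob n) : dC n (eval_chain val X) = eval_chain val (formal_d X).
  apply/(@eq_mod_eq0 (cob Ftau n.+1))/(@liftn_eq0 Ftau n.+1).
  by apply: (eval_d comodule_Ftau S0) => v; exact: (eq_mod_refl (stable_liftn 1 S0)).
have zX : z = eval_chain val generic_deg7.
  apply/ffunP=> m3; apply/ffunP=> m2; apply/ffunP=> m1; rewrite -[LHS]/(zc m1 m2 m3).
  rewrite !ffunE !get_tab; set x := (X in _ = X).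
  have xE : x = if (mon_deg m1 + mon_deg m2 + mon_deg m3 == 7)%N && (2 <= wt3 m1 m2 m3)%N
      then 'X^(wt3 m1 m2 m3 - 2) * (coef m1 m2 m3)%:P else 0 :> {poly 'F_2}.
    rewrite /x -/(wt3 m1 m2 m3); case: ifP => _;
      rewrite /= /eval_form ?big_nil // big_cons big_nil addr0.
    by rewrite /eval_term [iter _ _ _]iter_tau_poly /= /val /c !word_decode3.
  have zc0 i : (zc m1 m2 m3)`_i != 0 ->
      (mon_deg m1 + mon_deg m2 + mon_deg m3 == 7)%N && (wt3 m1 m2 m3 == i + 2)%N.
    by move=> /(degz m3 m2 m1 i)[]; rewrite /wt3; lia.
  apply/polyP=> i; rewrite xE; case: ifP => [_|bad]; last first.
    rewrite coef0; apply/eqP; apply: contraFT bad => /zc0/andP[-> /eqP ->].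
    by rewrite leq_addl.
  rewrite coefXnM coefC; case: ltngtP => [lt_i|gt_i|->]; last by rewrite subnn.
    by apply/eqP; apply: contraT => /zc0/andP[_]; lia.
  rewrite ifF; last by lia.
  by apply/eqP; apply: contraT => /zc0/andP[_]; lia.
have rels r : r \in tau_parts [:: 0%N; 1%N] (formal_d generic_deg7) -> eval_lin c r = 0.
  move: r; apply: tau_partsP => L i LX _; rewrite -coef_eval_form.
  have d0 : @liftn Ftau (fun y => y = 0) 4 (eval_chain val (formal_d generic_deg7)).
    by rewrite -dval -zX [dC _ _]dz; exact: (stable0 (stable_liftn 4 S0)).
  by rewrite (leaves_eval_chain d0 LX) coef0.
pose E := @eval_chain Ftau val 3 (map_leaves (subst_form a_coef) a_form).
exists (eval_lin c a_coef), (eval_chain val bound_deg7).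
have <- : E = eval_chain (fun=> (eval_lin c a_coef)%:P : Ftau) a_form.
  have vE : eval_lin val a_coef = (eval_lin c a_coef)%:P by
    rewrite /eval_lin [RHS](raddf_sum polyC).
  by rewrite /E -vE; apply: (@eval_chain_map Ftau val (fun=> eval_lin val a_coef)
    (subst_form a_coef) 3 a_form) => L; exact: eval_form_subst.
rewrite dval /E -(evaluationD (eval_chainP val 3)) zX.
apply/(@eq_mod_eq0 (cob Ftau 3))/(@liftn_eq0 Ftau 3).
rewrite /eq_mod -[X in _ - X]oppx opprK -(evaluationD (eval_chainP val 3)).
apply: eval_chain_leaves => L LX; have /allP/(_ L LX)/andP[/allP degL /allP redL] :=
  deg7_check.
apply/polyP=> k; rewrite coef_eval_form coef0.
have [kI|kI] := boolP (k \in [:: 0%N; 1%N]); first exact: eval_lin_eq0 rels (redL k kI).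
rewrite (_ : tau_part k L = [::]) ?/eval_lin ?big_nil //.
rewrite /tau_part (_ : filter _ L = [::]) //; apply/eqP;
  rewrite -(negbK (_ == _)) -has_filter.
apply/negP => /hasP[t tL /andP[/eqP ik /eqP r0]].
by have := degL t tL; rewrite ik r0 (negbTE kI).
Qed.

(** * Generators and the conclusion *)

Lemma fil_mem_leq p q n (x : cob NC n) : q <= p -> fil_mem p x -> fil_mem q x.
Proof.
move=> le_qp; elim: n x => [|n IHn] x Fx; first exact: fil_leq Fx.
by move=> m; apply: IHn; exact: Fx.
Qed.

Section Generators.
Variables (h0 h1 : ExtC 1) (a : ExtC 3) (b : ExtC 4).
Hypothesis hExt : ExtC_presentation h0 h1 a b.
Local Notation gens := [tuple inC tauC; inC h0; inC h1; inC a; inC b].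

(** The product of gradedC is a bare operation with a unit, so products over
    the five generators cannot be rearranged; here only one factor differs
    from the unit. *)
Lemma big_gext_single (F : 'I_5 -> gradedC) i : (forall l, l != i -> F l = gext_one) ->
  \big[gext_mul/gext_one]_l F l = F i.
Proof.
move=> F1.
have all1 (s : seq 'I_5) : i \notin s -> \big[gext_mul/gext_one]_(l <- s) F l = gext_one.
  elim: s => [|l s IHs]; first by rewrite big_nil.
  rewrite in_cons negb_or eq_sym => /andP[/F1 Fl /IHs Es].
  by rewrite big_cons Fl Es gext_mulg1.
have : i \in index_enum 'I_5 by exact: mem_index_enum.
elim: (index_enum _) (index_enum_uniq 'I_5) => // l s IHs /= /andP[ls us].
rewrite in_cons big_cons; have [il _|ne_li /= si] := eqVneq i l.
  by subst l; rewrite all1 // gext_mulg1.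
by rewrite IHs // F1 1?eq_sym // (gext_mul1g hExt).
Qed.

(** A monomial that evaluates to zero is in the ideal of relations, and
    vanishes at every common zero c of the relations. *)
Lemma generator_exp_neq0 (c : seq 'F_2) i k n (u : ExtC n) :
  (i < 5)%N -> gext_exp (tnth gens (inord i)) k = inC u ->
  [/\ c`_1 * c`_2 = 0, c`_0 * c`_2 ^+ 3 = 0, c`_2 * c`_3 = 0 &
      c`_3 ^+ 2 + c`_1 ^+ 2 * c`_4 = 0] ->
  c`_i ^+ k != 0 -> u <> 0.
Proof.
move=> lt_i5 gu [c1 c2 c3 c4] nz u0; pose v (l : 'I_5) := c`_l.
have vE l : (l < 5)%N -> v (inord l) = c`_l by move=> lt_l; rewrite /v inordK.
case: hExt => _ _ _ /(_ (var i ^+ k)) [+ _].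
case=> [d|q1 [q2 [q3 [q4 E]]]].
  rewrite /var mpolyXn /evalC msuppX big_seq1 (@big_gext_single _ (inord i)) => [|l ne_l].
    rewrite mulmnE mnm1E eqxx mul1n gu u0.
    have [dn|nd] := eqVneq n d; last by rewrite untag_dflt.
    by subst d; rewrite (untagE _ _ (erefl n : tag (inC (0 : ExtC n)) = n)).
  by rewrite mulmnE mnm1E [inord i == l]eq_sym (negbTE ne_l).
have : meval v (var i ^+ k) = 0.
  by rewrite E !(mevalD, mevalM, rmorphXn, mevalXU) !vE // c1 c2 c3 c4 !mulr0 !addr0.
by rewrite rmorphXn /= mevalXU vE // => /eqP; exact/negP.
Qed.

Lemma gens_nth i : (i < 5)%N -> tnth gens (inord i) = nth (inC tauC) gens i.
Proof. by move=> lt_i; rewrite (tnth_nth (inC tauC)) inordK. Qed.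

Lemma h0_neq0 : h0 <> 0.
Proof.
(* The coordinates are those of tau, h0, h1, a, b; over F_2 the relation a^2
   + h0^2 b vanishes at a = h0 = b = 1. *)
apply: (@generator_exp_neq0 [:: 0; 1; 0; 1; 1] 1 1) => //.
  by rewrite gens_nth // /gext_exp /= gext_mulg1.
by split; apply/val_inj.
Qed.
Lemma a_neq0 : a <> 0.
Proof.
apply: (@generator_exp_neq0 [:: 0; 1; 0; 1; 1] 3 1) => //.
  by rewrite gens_nth // /gext_exp /= gext_mulg1.
by split; apply/val_inj.
Qed.
Lemma h1_cube_neq0 : (ext_mul h1 (ext_mul h1 h1) : ExtC 3) <> 0.
Proof.
apply: (@generator_exp_neq0 [:: 0; 0; 1; 0; 0] 2 3); first by [].
- rewrite (gens_nth (isT : (2 < 5)%N)) /gext_exp !iterS [iter 0 _ _]/= gext_mulg1.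
  by rewrite (_ : nth (inC tauC) gens 2 = inC h1).
- by split; apply/val_inj.
by [].
Qed.
End Generators.

Definition a_cocycle : cob Ftau 3 := eval_chain (fun=> (1 : {poly 'F_2}) : Ftau) a_form.

(** The cohomology in the degree of a is spanned by the class of this
    cochain, and a is not zero. *)
Lemma a_class (a : ExtC 3) : degC 4 2 a -> a <> 0 ->
  dC 3 a_cocycle = 0 /\ a = clsC a_cocycle.
Proof.
case=> z [dz degz az] a_nz; have [e [y zE]] := cocycle_degree_a dz degz.
have S0 := stable_eq0 Ftau.
case: (F2P e) => e_val; rewrite e_val in zE.
  case: a_nz; rewrite az; apply: cls_eq0; first exact: dz.
  exists y => //; rewrite zE [eval_chain _ _](_ : _ = 0) ?add0r //.
  by apply/(@liftn_eq0 Ftau 3)/(stable_eval_chain S0).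
have dm : dC 3 a_cocycle = 0.
  by have := dz; rewrite zE raddfD [X in _ + X](dC_dC y) addr0.
split; first exact: dm.
rewrite az; apply/clsC_eq; [exact: dz | exact: dm |].
exists y; first exact: I.
have zE' : z = a_cocycle + dC 2 y by exact: zE.
by rewrite zE' addrC addKr.
Qed.

(** In this degree a nonzero class of the first page is represented by gamma
    / (rho^(1+j) tau) c0. *)
Lemma d1_lift (a : ExtC 3) j (x : Eminus 1 (1 + j) 2) :
  degC 4 2 a -> a <> 0 -> x <> 0 -> degE (4 + (1 + j))%N%:Z (4 + (1 + j))%N%:Z x ->
  d_ x = gamE j 2 a.
Proof.
move=> dega a_nz x_nz [z [Zz degz xz]].
have [dm ->] := a_class dega a_nz; rewrite (gamE_clsC _ _ dm).
have [e [y [Fy Fz]]] := E1_degree_lift Zz degz.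
case: (F2P e) => e_val; rewrite e_val in Fz.
  case: x_nz; rewrite xz; apply: cls_eq0 => //.
  move: Fz; rewrite [eval_chain _ _](_ : _ = 0) ?add0r => [Fz|].
    by rewrite -[z](subrK (dNC 1 y)); apply: BrD; [exact: Br_fil | exact: Br_d].
  by apply/(@liftn_eq0 NC 2)/(stable_eval_chain (stable_eq0 NC)) => _; rewrite scale0r.
rewrite scale1r in Fz; set g := eval_chain _ _ in Fz.
have dg : fil_mem (- j%:Z + 1) (dNC 2 g - gam_tens j 2 a_cocycle) := @d_c0_form j.
have Fg : fil_mem (- (1 + j)%N%:Z) g.
  by apply/fil_liftn/(stable_eval_chain (stable_fil _)) => _; exact: fil_gam.
have Fdg : fil_mem (- j%:Z) (dNC 2 g).
  rewrite -[dNC 2 g](subrK (gam_tens j 2 a_cocycle)).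
  have FD := stableD (stable_liftn 3 (stable_fil (- j%:Z))).
  apply/fil_liftn; apply: FD; apply/fil_liftn; last exact: gam_tens_fil.
  by apply: fil_mem_leq dg; rewrite lerDl.
have Zg : Zr dNC fil 1 (- (1 + j)%N%:Z) 2 g.
  by split; [exact: Fg | rewrite opp_succ; exact: Fdg].
rewrite xz (_ : clsE (1 + j) z = clsE (1 + j) g); first exact: (d_clsE Zg dg).
apply: (clsE_eq Zz Zg).
have regroup (V : zmodType) (u v w : V) : u - v = u - (v + w) + w.
  by rewrite opprD addrA subrK.
rewrite (regroup _ z g (dNC 1 y)).
by apply: BrD; [exact: Br_fil | exact: Br_d].
Qed.

Local Close Scope ring_scope.

Theorem proposition7p7 (h0 h1 : ExtC 1) (a : ExtC 3) (b : ExtC 4)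
    (hExt : ExtC_presentation h0 h1 a b) :
  (forall k j : nat,
     d_ (gamE (1 + j) (2 * k + 1) oneC : Eminus 1 (1 + j) 0)
       = gamE j (2 * k + 2) h0 :> Eminus 1 j 1) /\
  (forall (j : nat) (Q : Eminus 1 (1 + j) 2),
     is_Qh1cube h1 Q -> d_ Q = gamE j 2 a :> Eminus 1 j 3).
Proof.
have [[degh0 _ dega _] _ _ _] := hExt.
split=> [k j|j Q [degQ TorQ]].
  have [dt ->] := h0_eq_tau0 degh0 (h0_neq0 hExt).
  rewrite (gamE_clsC _ _ dt) (gamE_clsC _ _ (dC0 _)).
  apply: d_clsE.
    by apply: Zr_gam_tens; rewrite dC0 gam_tensE;
      exact: (morph0 (morph_cobmap 1 (stable_fil _) (morph_mul_gam _ _))).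
  have gE : @gam_tens (1 + j) (2 * k + 1) 0 (1%R : {poly 'F_2}) = gam (1 + j) (2 * k + 1).
    exact: mul_gam1.
  by rewrite gE; exact: d_gam_odd.
apply: d1_lift; [exact: dega | exact: (a_neq0 hExt) | | exact: degQ].
by move=> Q0; apply: (h1_cube_neq0 hExt); exact: (Tor_proj_eq0 TorQ Q0).
Qed.
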